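(* Let $\Sigma=\partial\Omega$ be a sphere centered at $x^0$. Then the system of pairs $$\left\{\left(p_k\cdot\nu,\ Tp_k-(Tp_k\cdot\nu)\nu\right)\right\}_{k=0,1,2,\ldots}$$ is complete in the subspace $\widetilde V^0$ of $C^0(\Sigma)\times[C^0(\Sigma)]^3_0$ defined by $$\widetilde V^0=\left\{(f,F)\in C^0(\Sigma)\times[C^0(\Sigma)]^3_0\ :\ \int_\Sigma F\cdot(b\wedge(x-x^0))\,d\sigma=0\quad\forall\, b\in\mathbb R^3\right\},$$ i.e. the linear span of the system is contained in $\widetilde V^0$ and is dense in $\widetilde V^0$ with respect to the uniform norm.
   Context: $\Omega\subset\mathbb R^3$ is a bounded domain such that $\mathbb R^3\setminus\Omega$ is connected, with boundary $\Sigma$ (here a sphere, so $\Omega$ is a ball); $\nu$ is the outward unit normal to $\Sigma$ and $d\sigma$ is surface measure. $\lambda,\mu$ are real constants (Lamé constants) with $\mu>0$, $3\lambda+2\mu>0$. The elasticity operator is $Eu=\mu\Delta u+(\lambda+\mu)\nabla\operatorname{div}u$ for $u=(u_1,u_2,u_3)$, and the stress operator on $\Sigma$ is $Tu=2\mu\frac{\partial u}{\partial\nu}+\lambda(\operatorname{div}u)\nu+\mu(\nu\wedge\operatorname{curl}u)$, where $\wedge$ is the vector product. $\{p_k\}_{k\ge 0}$ is the system of polynomial vector solutions of $Eu=0$ obtained as follows: for each $k\ge0$ let $\omega_{ks}(x)=|x|^kY_{ks}(x/|x|)$, $s=1,\ldots,2k+1$, be a basis of the homogeneous harmonic polynomials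 of degree $k$ ($Y_{ks}$ spherical harmonics), let $\Lambda_k=-\frac{\lambda+\mu}{2(\lambda(k-1)+\mu(3k-2))}$, and let $e_1,e_2,e_3$ be the standard basis; the vectors $\omega_{ks}e_j+\Lambda_k|x|^2\nabla(\partial_j\omega_{ks})$ ($j=1,2,3$; $s=1,\ldots,2k+1$; $k=0,1,\ldots$), ordered in one sequence, are the $p_k$. Every polynomial vector solution of $Eu=0$ is a finite linear combination of the $p_k$. $C^0(\Sigma)$ is the space of real continuous functions on $\Sigma$ with the uniform norm, and $[C^0(\Sigma)]^3_0=\{F\in[C^0(\Sigma)]^3 : F\cdot\nu=0 \text{ on }\Sigma\}$. *)

(* Defs.v *)
From HB Require Import structures.
From mathcomp Require Import all_boot all_order all_algebra.
From mathcomp Require mpoly.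

Set Implicit Arguments.
Unset Strict Implicit.
Unset Printing Implicit Defensive.

(* The notations of mpoly and of MathComp-Analysis are incompatible; the module
   confines the former. *)
Module Poly3.
Import GRing.Theory mpoly.
Local Open Scope ring_scope.

Definition homog_poly (R : comNzRingType) (k : nat) (f : 'rV[R]_3 -> R) : Prop :=
  exists2 p : {mpoly R[3]}, p \is k.-homog & forall x, f x = p.@[fun i => x ord0 i].

End Poly3.

From mathcomp Require Import all_classical all_reals all_analysis.
Import Order.TTheory GRing.Theory Num.Theory numFieldNormedType.Exports.

Local Open Scope classical_set_scope.
Local Open Scope ring_scope.

Notation homog_poly := Poly3.homog_poly.

Section Elasticity.
Context {R : realType}.
Local Notation vec := 'rV[R]_3.
Implicit Types (x y u v b : vec) (f : vec -> R) (w : vec -> vec).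

Definition dot u v : R := \sum_(i < 3) u ord0 i * v ord0 i.

(* The library norm of 'rV[R]_3 is the max norm. *)
Definition enorm u : R := Num.sqrt (dot u u).

(* Indices are added in 'I_3, i.e. modulo 3. *)
Definition cross u v : vec :=
  \row_(i < 3) (u ord0 (i + 1) * v ord0 (i + 2) - u ord0 (i + 2) * v ord0 (i + 1)).

Definition evec (i : 'I_3) : vec := delta_mx ord0 i.

Definition pderiv (i : 'I_3) f x : R := 'D_(evec i) f x.

Definition component (i : 'I_3) w : vec -> R := fun x => w x ord0 i.

Definition grad f x : vec := \row_(i < 3) pderiv i f x.

Definition divergence w x : R := \sum_(i < 3) pderiv i (component i w) x.

Definition curl w x : vec :=
  \row_(i < 3) (pderiv (i + 1) (component (i + 2) w) x
                - pderiv (i + 2) (component (i + 1) w) x).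

Definition laplacian f x : R := \sum_(i < 3) pderiv i (pderiv i f) x.

Definition sphere (x0 : vec) (r : R) : set vec := [set x | enorm (x - x0) = r].

(* On sphere x0 r this is the outward unit normal; values elsewhere are not used. *)
Definition unit_normal (x0 : vec) (r : R) : vec -> vec := fun x => r^-1 *: (x - x0).

Definition stress (lam mu : R) (nu w : vec -> vec) x : vec :=
  (2 * mu) *: 'D_(nu x) w x + (lam * divergence w x) *: nu x
  + mu *: cross (nu x) (curl w x).

Definition sphere_param (x0 : vec) (r theta phi : R) : vec :=
  x0 + r *: \row_(i < 3) [:: sin theta * cos phi; sin theta * sin phi; cos theta]`_i.

(* Integration against surface measure, in spherical coordinates: the area
   element of sphere_param is r^2 sin(theta) dtheta dphi. *)
Definition sphere_integral (x0 : vec) (r : R) f : R :=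
  \int[lebesgue_measure]_(theta in `[0, pi])
    \int[lebesgue_measure]_(phi in `[0, 2 * pi])
      (f (sphere_param x0 r theta phi) * (r ^+ 2 * sin theta)).

Definition harmonic_homog (k : nat) : set (vec -> R) :=
  [set f | homog_poly k f /\ forall x, laplacian f x = 0].

Definition is_basis (V : lmodType R) (n : nat) (W : set V) (e : 'I_n -> V) : Prop :=
  [/\ forall s, W (e s),
      forall z, W z -> exists c : 'I_n -> R, z = \sum_(s < n) c s *: e s &
      forall c : 'I_n -> R, \sum_(s < n) c s *: e s = 0 -> forall s, c s = 0].

Definition Lambda (lam mu : R) (k : nat) : R :=
  - ((lam + mu) / (2 * (lam * (k%:R - 1) + mu * (3 * k%:R - 2)))).

Definition elastic_poly (lam mu : R) (k : nat) (omega : vec -> R) (j : 'I_3) :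
    vec -> vec :=
  fun x => omega x *: evec j
           + (Lambda lam mu k * enorm x ^+ 2) *: grad (pderiv j omega) x.

(* Indices (k, s, j) of the vectors elastic_poly lam mu k (omega k s) j. *)
Definition elastic_index : Type := {k : nat & ('I_(2 * k).+1 * 'I_3)%type}.

Definition elastic_system (lam mu : R)
    (omega : forall k : nat, 'I_(2 * k).+1 -> (vec -> R)) (i : elastic_index) :
    vec -> vec :=
  let: existT k (s, j) := i in elastic_poly lam mu k (omega k s) j.

(* A function on the sphere is represented by a function on the whole space of
   which only the restriction to the sphere matters. *)
Local Notation sphere_pair := ((vec -> R) * (vec -> vec))%type.

Definition boundary_pair (lam mu : R) (x0 : vec) (r : R) w : sphere_pair :=
  let nu := unit_normal x0 r in
  let t := stress lam mu nu w in
  (fun x => dot (w x) (nu x), fun x => t x - dot (t x) (nu x) *: nu x).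

Definition Vtilde (x0 : vec) (r : R) : set sphere_pair :=
  [set g | [/\ {within sphere x0 r, continuous g.1},
               {within sphere x0 r, continuous g.2},
               forall x, sphere x0 r x -> dot (g.2 x) (unit_normal x0 r x) = 0 &
               forall b, sphere_integral x0 r
                           (fun x => dot (g.2 x) (cross b (x - x0))) = 0]].

Definition linear_span (V : lmodType R) (g : nat -> V) : set V :=
  [set z | exists (n : nat) (c : nat -> R), z = \sum_(k < n) c k *: g k].

Definition uniformly_dense (S : set vec) (A B : set sphere_pair) : Prop :=
  forall g, B g -> forall eps : R, 0 < eps ->
    exists2 h, A h & forall x, S x ->
      `|g.1 x - h.1 x| < eps /\ enorm (g.2 x - h.2 x) < eps.

Definition complete_in (S : set vec) (g : nat -> sphere_pair) (B : set sphere_pair) :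
    Prop :=
  linear_span g `<=` B /\ uniformly_dense S (linear_span g) B.

End Elasticity.

(* Main.v *)
Require Import Defs.
From mathcomp Require Import all_boot all_order all_algebra.
From mathcomp Require mpoly.
From mathcomp Require Import ring lra.

(** Put y = x - x0.  Up to a factor r, the boundary data of a field u on the
    sphere |y| = r are the values of y.u and the tangential part of

      traction u = 2 mu (y.grad) u + lam (div u) y + mu y /\ curl u ,

    so for a polynomial u everything is polynomial in y, and what matters is
    the polynomial modulo |y|^2 - r^2 and, for the traction, modulo multiples
    of y.

    The span consists of elastic data.  Every polynomial solution of the Lame
    system is a finite combination of the p_k: its homogeneous components are
    again solutions, and a solution u of degree k becomes harmonic after the
    subtraction of a multiple of |y|^2 grad div u (hom_elastic_field,
    elastic_ind).  As the Lame system is invariant under translations, the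
    linear span is the set of all boundary data of polynomial solutions in the
    variable y, wherever the centre x0 lies (span_elastic).

    The moment condition.  The components of y /\ grad are infinitesimal
    rotations, so polynomials in their range have mean zero over the sphere.
    The moment of the traction against b /\ y lies in that range: up to
    radial terms and gradients the traction of a homogeneous solution of
    degree k is mu (k - 1) times a harmonic field of degree k, which is
    orthogonal to the linear field b /\ y unless k = 1 (rotsum_traction).
    In spherical coordinates the mean of a rotational derivative vanishes by
    the fundamental theorem of calculus (polar_int_rot).

    Polynomial data are attained.  If h is a homogeneous harmonic polynomial
    of degree k, three solutions are explicit: y /\ grad h, grad h, and
    |y|^2 grad h + c_k h y.  The first has data (0, y /\ grad h) up to the
    factor mu (k - 1).  The other two have data in the plane of (h, 0) and
    (0, grad h), and they span it, the determinant being positive since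
    mu > 0 and 3 lam + 2 mu > 0 (det_gt0).  On the sphere every polynomial is
    a sum of harmonic ones (hspan_all), and the tangential part of every
    polynomial field is a sum of fields grad h and y /\ grad h, by
    harm_vec_decomp.  Hence all polynomial data (f, F) are attained, except
    that F is attained only up to a field y /\ c, the case k = 1 of the first
    family (solvable_normal, tsolvable_all).

    Density.  Continuous functions on the sphere are uniform limits of
    polynomials (sphere_weierstrass).  If (f, F) satisfies the moment
    condition and P approximates F, then the elastic data attained for P have
    tangential part P + y /\ c, and both F and these data have zero moment
    against y /\ c; the mean square of y /\ c is thus bounded by the error
    of the approximation, and so is c (density). *)

Set Implicit Arguments.
Unset Strict Implicit.
Unset Printing Implicit Defensive.

Module PolyElasticity.
Import Order.TTheory GRing.Theory Num.Theory mpoly.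
Local Open Scope ring_scope.

(** * Polynomial vector calculus in three variables *)

(** Expanding from an arbitrary index i keeps the identities below cyclically
    symmetric, so that one computation covers the three components. *)
Lemma sum3 (V : nmodType) (F : 'I_3 -> V) (i : 'I_3) :
  \sum_(j < 3) F j = F i + F (i + 1) + F (i + 2).
Proof.
rewrite !big_ord_recl big_ord0 addr0 addrA.
set a := ord0; set b := lift _ _; set c := lift _ _.
have [[-> -> ->]|[-> -> ->]|[-> -> ->]] :
  [\/ [/\ i = a, i + 1 = b & i + 2 = c], [/\ i = b, i + 1 = c & i + 2 = a] |
   [/\ i = c, i + 1 = a & i + 2 = b]].
- case: i => -[|[|[|//]]] Hi; [apply: Or31|apply: Or32|apply: Or33];
  by split; apply: val_inj.
- by [].
- by rewrite -addrA addrC.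
- by rewrite addrC addrA.
Qed.

Lemma ord3_11 (i : 'I_3) : i + 1 + 1 = i + 2.
Proof. by case: i => -[|[|[|//]]] Hi; apply: val_inj. Qed.
Lemma ord3_12 (i : 'I_3) : i + 1 + 2 = i.
Proof. by case: i => -[|[|[|//]]] Hi; apply: val_inj. Qed.
Lemma ord3_21 (i : 'I_3) : i + 2 + 1 = i.
Proof. by case: i => -[|[|[|//]]] Hi; apply: val_inj. Qed.
Lemma ord3_22 (i : 'I_3) : i + 2 + 2 = i + 1.
Proof. by case: i => -[|[|[|//]]] Hi; apply: val_inj. Qed.
Definition ord3E := (ord3_11, ord3_12, ord3_21, ord3_22).

Lemma ord3_eqF (i : 'I_3) :
  ((((i == (i + 1)%R) = false) * ((i == (i + 2)%R) = false)) *
   ((((i + 1)%R == i) = false) * (((i + 2)%R == i) = false)) *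
   ((((i + 1)%R == (i + 2)%R) = false) * (((i + 2)%R == (i + 1)%R) = false)))%type.
Proof. by case: i => -[|[|[|//]]] Hi. Qed.

Lemma ord3_cases (i : 'I_3) : [\/ i = 0, i = 0 + 1 | i = 0 + 2].
Proof.
by case: i => -[|[|[|//]]] Hi; [apply: Or31|apply: Or32|apply: Or33]; apply: val_inj.
Qed.

Section PolyCalculus.
Context (R : realFieldType).
Local Notation P := {mpoly R[3]}.
Implicit Types (p q f g h : P) (i j : 'I_3) (u v : 'I_3 -> P) (a b c : R).

Definition D i p : P := mderiv i p.
Definition X i : P := 'X_i.

Lemma DM i p q : D i (p * q) = D i p * q + p * D i q.
Proof. exact: mderivM. Qed.
Lemma Dadd i p q : D i (p + q) = D i p + D i q.
Proof. exact: mderivD. Qed.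
Lemma Dopp i p : D i (- p) = - D i p.
Proof. exact: mderivN. Qed.
Lemma DC i c : D i c%:MP = 0.
Proof. exact: mderivC. Qed.
Lemma D0 i : D i 0 = 0.
Proof. exact: mderiv0. Qed.
Lemma Dcomm i j p : D i (D j p) = D j (D i p).
Proof. exact: mderiv_comm. Qed.
Lemma DX i j : D i (X j) = (i == j)%:R.
Proof.
rewrite /D /X mderivX mnm1E eq_sym; case: eqP => [->|_]; last by rewrite scale0r.
rewrite scale1r (_ : (_ - _)%MM = 0%MM) ?mpolyX0 //.
by apply/mnmP => k; rewrite mnmBE subnn mnm0E.
Qed.
Lemma Dmuln i p n : D i (p *+ n) = D i p *+ n.
Proof. exact: mderivMn. Qed.
Lemma D_sum i (I : Type) (s : seq I) (Q : pred I) (F : I -> P) :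
  D i (\sum_(k <- s | Q k) F k) = \sum_(k <- s | Q k) D i (F k).
Proof. by apply: (big_morph _ (Dadd i) (D0 i)). Qed.

Lemma D1 i : D i 1 = 0.
Proof. exact: (DC i 1). Qed.

Definition DE := (DM, Dadd, Dopp, DC, Dmuln).

Lemma DXE i :
  [/\ [/\ D i (X i) = 1, D i (X (i + 1)) = 0 & D i (X (i + 2)) = 0],
     [/\ D (i + 1) (X i) = 0, D (i + 1) (X (i + 1)) = 1 & D (i + 1) (X (i + 2)) = 0] &
     [/\ D (i + 2) (X i) = 0, D (i + 2) (X (i + 1)) = 0 & D (i + 2) (X (i + 2)) = 1]].
Proof.
by rewrite !DX !eqxx !ord3_eqF.
Qed.

Definition euler p := \sum_i X i * D i p.
Definition lap p := \sum_i D i (D i p).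
Definition divg u := \sum_i D i (u i).
Definition dotv u v := \sum_i u i * v i.
Definition crossv u v i := u (i + 1) * v (i + 2) - u (i + 2) * v (i + 1).
Definition curlv u i := D (i + 1) (u (i + 2)) - D (i + 2) (u (i + 1)).
Definition gradv p i := D i p.
Definition sqnorm := dotv X X.
(** The vector x /\ grad p; its components are the infinitesimal rotations
    about the axes, which are tangent to the spheres centred at the origin. *)
Definition rotd p := crossv X (gradv p).

(* Both sides become polynomials in the coordinates and in the partial
   derivatives of the data, mixed derivatives being put in a fixed order. *)
Ltac expand i :=
  rewrite /rotd /sqnorm /dotv /euler /lap /divg /crossv /curlv /gradv ?(sum3 _ i) ?ord3E;
  have [[? ? ?] [? ? ?] [? ? ?]] := DXE i;
  do !(rewrite ?DE; match goal with H : D _ (X _) = _ |- _ => rewrite ?{}H end);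
  rewrite ?(DC, D0, D1, DE) ?(Dcomm (i + 1) i) ?(Dcomm (i + 2) i) ?(Dcomm (i + 2) (i + 1)).

Lemma D_sqnorm i : D i sqnorm = X i *+ 2.
Proof. rewrite /sqnorm /dotv (sum3 _ i) !DE; by have [[-> -> ->] _ _] := DXE i; ring. Qed.
Lemma eulerM p q : euler (p * q) = euler p * q + p * euler q.
Proof. rewrite /euler !(sum3 _ 0) !DM; ring. Qed.
Lemma lap_X i p : lap (X i * p) = X i * lap p + D i p *+ 2.
Proof. expand i; ring. Qed.
Lemma lap_sqnorm p : lap (sqnorm * p) = p *+ 6 + euler p *+ 4 + sqnorm * lap p.
Proof. move: (0 : 'I_3) => i; expand i; ring. Qed.
Lemma euler_sqnorm p : euler (sqnorm * p) = sqnorm * p *+ 2 + sqnorm * euler p.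
Proof. move: (0 : 'I_3) => i; expand i; ring. Qed.
Lemma euler_D i p : euler (D i p) = D i (euler p) - D i p.
Proof. expand i; ring. Qed.
Lemma lap_D i p : lap (D i p) = D i (lap p).
Proof. expand i; ring. Qed.
Lemma euler_rotd p i : euler (rotd p i) = rotd (euler p) i.
Proof. expand i; ring. Qed.
Lemma lapD p q : lap (p + q) = lap p + lap q.
Proof. rewrite /lap !(sum3 _ 0) !DE; ring. Qed.
Lemma lapN p : lap (- p) = - lap p.
Proof. rewrite /lap !(sum3 _ 0) !DE; ring. Qed.
Lemma lapC c p : lap (c%:MP * p) = c%:MP * lap p.
Proof. rewrite /lap !(sum3 _ 0) !DE ?D0; ring. Qed.
Lemma eulerD p q : euler (p + q) = euler p + euler q.
Proof. rewrite /euler !(sum3 _ 0) !DE; ring. Qed.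
Lemma eulerN p : euler (- p) = - euler p.
Proof. rewrite /euler !(sum3 _ 0) !DE; ring. Qed.
Lemma eulerC c : euler c%:MP = 0.
Proof. rewrite /euler !(sum3 _ 0) !DC; ring. Qed.
Lemma eulerX i : euler (X i) = X i.
Proof. expand i; ring. Qed.
Lemma lap_rotd p i : lap (rotd p i) = rotd (lap p) i.
Proof. rewrite /rotd /crossv /gradv lapD lapN !lap_X !lap_D (Dcomm (i + 2) (i + 1)); ring. Qed.
Lemma euler_lap p : euler (lap p) = lap (euler p) - lap p *+ 2.
Proof.
transitivity (\sum_i euler (D i (D i p))); first by rewrite [RHS](sum3 _ 0) /lap (sum3 _ 0) !eulerD.
under eq_bigr do rewrite euler_D euler_D Dadd Dopp -addrA -opprD.
by rewrite big_split sumrN big_split mulr2n.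
Qed.
Lemma divg_rotd p : divg (rotd p) = 0.
Proof. move: (0 : 'I_3) => i; expand i; ring. Qed.
Lemma dotX_rotd p : dotv X (rotd p) = 0.
Proof. move: (0 : 'I_3) => i; expand i; ring. Qed.
Lemma divg_grad p : divg (gradv p) = lap p.
Proof. by []. Qed.
Lemma dotX_grad p : dotv X (gradv p) = euler p.
Proof. by []. Qed.
Lemma divg_X p : divg (fun i => X i * p) = p *+ 3 + euler p.
Proof. move: (0 : 'I_3) => i; expand i; ring. Qed.
(** This turns the curl term of the stress into a gradient and a radial
    derivative. *)
Lemma crossX_curl u i : crossv X (curlv u) i = D i (dotv X u) - u i - euler (u i).
Proof. expand i; ring. Qed.
Lemma lap_dotX u : lap (dotv X u) = dotv X (fun i => lap (u i)) + divg u *+ 2.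
Proof. move: (0 : 'I_3) => i; expand i; ring. Qed.
Lemma euler_dotX u : euler (dotv X u) = dotv X (fun i => euler (u i)) + dotv X u.
Proof. move: (0 : 'I_3) => i; expand i; ring. Qed.
Lemma euler_divg u : euler (divg u) = divg (fun i => euler (u i)) - divg u.
Proof. move: (0 : 'I_3) => i; expand i; ring. Qed.
Lemma curl_curl u i : curlv (curlv u) i = D i (divg u) - lap (u i).
Proof. expand i; ring. Qed.
Lemma crossXX_grad p i :
  crossv X (rotd p) i = X i * euler p - sqnorm * D i p.
Proof. expand i; ring. Qed.
(** Splitting of the Laplacian into its radial and angular parts.  On a
    harmonic polynomial of degree k the angular part is the factor -k(k+1). *)
Lemma rotd_rotd p : \sum_i rotd (rotd p i) i = sqnorm * lap p - euler (euler p) - euler p.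
Proof. move: (0 : 'I_3) => i; expand i; ring. Qed.
Lemma euler_curl u i : euler (curlv u i) = curlv (fun j => euler (u j)) i - curlv u i.
Proof. expand i; ring. Qed.
Lemma divg_curl u : divg (curlv u) = 0.
Proof. move: (0 : 'I_3) => i; expand i; ring. Qed.
Lemma rotdM p q i : rotd (p * q) i = rotd p i * q + p * rotd q i.
Proof. expand i; ring. Qed.
(** Two axes of rotation generate the third one. *)
Lemma rotd_comm p i : rotd p (i + 1) = rotd (rotd p (i + 2)) i - rotd (rotd p i) (i + 2).
Proof. expand i; ring. Qed.
End PolyCalculus.

(** * Homogeneity *)

Section Hom.
Context (R : realFieldType).
Local Notation P := {mpoly R[3]}.
Implicit Types (p q f g h : P) (i j : 'I_3) (u v : 'I_3 -> P) (a b c : R).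

Lemma mcoeff_euler p m : (euler p)@_m = (mdeg m)%:R * p@_m.
Proof.
elim/mpolyind: p => [|c m' p _ _ IH].
  by rewrite /euler big1 ?mcoeff0 ?mulr0 // => i _; rewrite D0 mulr0.
rewrite eulerD !mcoeffD IH mulrDr; congr (_ + _).
have -> : euler (c *: 'X_[m']) = (mdeg m')%:R *: (c *: 'X_[m']).
  rewrite /euler mdegE natr_sum scaler_suml; apply: eq_bigr => i _.
  rewrite /D /X mderivZ mderivX -!scalerAr [RHS]scalerA [_ * c]mulrC -scalerA.
  case: (posnP (m' i)) => [->|mi]; first by rewrite !scale0r.
  rewrite -mpolyXD; congr (_ *: (_ *: 'X_[_])).
  by rewrite addmC submK // lep1mP -lt0n.
rewrite !mcoeffZ mcoeffX; case: eqP => [->|_] //=; by rewrite ?mulr0.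
Qed.

(** Euler's identity, with a degree in R: derivation lowers the degree without
    truncation, and a polynomial of degree -1 is zero. *)
Definition hom a p := euler p = a%:MP * p.

Lemma hom_coeff a p m : hom a p -> p@_m != 0 -> a = (mdeg m)%:R.
Proof.
move=> /(congr1 (mcoeff m)); rewrite mcoeff_euler mcoeffCM => /eqP.
by rewrite -subr_eq0 -mulrBl mulf_eq0 subr_eq0 => /orP[/eqP->//|->].
Qed.

Lemma hom_neg a p : a < 0 -> hom a p -> p = 0.
Proof.
move=> a0 hp; apply/mpolyP => m; rewrite mcoeff0; apply/eqP; apply: contraLR a0.
by move=> /(hom_coeff hp) ->; rewrite ltNge ler0n.
Qed.

Lemma hom0_const p : hom 0 p -> p = (p@_0)%:MP.
Proof.
move=> hp; apply/mpolyP => m; rewrite mcoeffC.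
case: eqP => [->|/eqP m0]; rewrite ?mulr1 ?mulr0 //; apply/eqP.
apply: contraR m0 => /(hom_coeff hp)/esym/eqP.
by rewrite pnatr_eq0 mdeg_eq0 eq_sym.
Qed.

Lemma dhomog_hom k p : p \is k.-homog -> hom k%:R p.
Proof.
move/dhomogP => hp; apply/mpolyP => m; rewrite mcoeff_euler mcoeffCM.
have [/hp <- //|] := boolP (m \in msupp p).
by rewrite -mcoeff_eq0 => /eqP->; rewrite !mulr0.
Qed.

Lemma hom_dhomog k p : hom k%:R p -> p \is k.-homog.
Proof.
move=> hp; apply/dhomogP => m; rewrite mcoeff_msupp => /(hom_coeff hp) /eqP.
by rewrite eqr_nat => /eqP.
Qed.

Lemma hom_D a p i : hom a p -> hom (a - 1) (D i p).
Proof.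
by rewrite /hom euler_D => ->; rewrite DM DC mpolyCB; ring.
Qed.
Lemma hom_rotd a p i : hom a p -> hom a (rotd p i).
Proof.
by rewrite /hom euler_rotd => ->; rewrite rotdM /rotd /crossv /gradv !DC; ring.
Qed.
Lemma hom_lap a p : hom a p -> hom (a - 2) (lap p).
Proof. by rewrite /hom euler_lap => ->; rewrite lapC mpolyCB; ring. Qed.

Lemma homM a b p q : hom a p -> hom b q -> hom (a + b) (p * q).
Proof. by rewrite /hom eulerM => -> ->; rewrite mpolyCD; ring. Qed.
Lemma homD a p q : hom a p -> hom a q -> hom a (p + q).
Proof. by rewrite /hom eulerD => -> ->; ring. Qed.
Lemma homC c : hom 0 c%:MP.
Proof. by rewrite /hom eulerC mpolyC0 mul0r. Qed.
Lemma homCM a c p : hom a p -> hom a (c%:MP * p).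
Proof. by rewrite -[a in X in _ -> X]add0r; apply: homM; exact: homC. Qed.
Lemma homN a p : hom a p -> hom a (- p).
Proof. by rewrite /hom eulerN => ->; ring. Qed.
Lemma homX i : hom 1 (X R i).
Proof. by rewrite /hom eulerX mul1r. Qed.
Lemma hom_sqnorm : hom 2 (sqnorm R).
Proof. by rewrite /hom -[sqnorm R]mulr1 euler_sqnorm (eulerC 1) mpolyCD; ring. Qed.
Lemma hom0 a : hom a 0.
Proof. by rewrite /hom -[0]/(0%:MP_[3]) eulerC mpolyC0 mulr0. Qed.
Definition hcomp k p : P := pihomog (@mdeg _) k p.

Lemma hom_hcomp k p : hom k%:R (hcomp k p).
Proof. exact/dhomog_hom/pihomogP. Qed.

Lemma hcomp_sum p n : (mmeasure (@mdeg _) p <= n)%N -> p = \sum_(k < n) hcomp k p.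
Proof. exact: pihomog_partitionE. Qed.

End Hom.

(** * Harmonic polynomials *)

Section Harm.
Context (R : realFieldType).
Local Notation P := {mpoly R[3]}.
Implicit Types (p q f g h : P) (i j : 'I_3) (u v : 'I_3 -> P) (a b c : R) (k : nat).
Local Notation X := (X R).
Local Notation sqnorm := (sqnorm R).

(** The degrees k - c being distinct, a monomial occurs in at most one of the
    summands. *)
Lemma hom_sum_eq0 n c (F : 'I_n -> P) :
  (forall k : 'I_n, hom (k%:R - c) (F k)) -> \sum_(k < n) F k = 0 -> forall k : 'I_n, F k = 0.
Proof.
move=> hF s0 k; apply/mpolyP => m; rewrite mcoeff0; apply/eqP/negPn/negP => hk.
have := congr1 (mcoeff m) s0; rewrite raddf_sum mcoeff0 (bigD1 k) //= big1 ?addr0; first by apply/eqP.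
move=> l lk; apply/eqP/negPn/negP => hl; case/eqP: lk; apply/ord_inj/eqP.
rewrite -(eqr_nat R); apply/eqP/(addIr (- c)).
by rewrite (hom_coeff (hF l) hl) (hom_coeff (hF k) hk).
Qed.

Definition harm k h := lap h = 0 /\ hom k%:R h.

Lemma harmD k p q : harm k p -> harm k q -> harm k (p + q).
Proof. by move=> [lp hp] [lq hq]; split; rewrite ?lapD ?lp ?lq ?addr0 //; apply: homD. Qed.
Lemma harmCM k c p : harm k p -> harm k (c%:MP * p).
Proof. by move=> [lp hp]; split; rewrite ?lapC ?lp ?mulr0 //; apply: homCM. Qed.
Lemma lap0 : lap 0 = 0 :> P.
Proof. by rewrite /lap big1 // => i _; rewrite !D0. Qed.
Lemma harm0 k : harm k 0.
Proof. by split; [exact: lap0 | exact: hom0]. Qed.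

Lemma harm0_D h i : harm 0 h -> D i h = 0.
Proof. by move=> [_ /(hom_D i)]; apply: hom_neg; rewrite sub0r oppr_lt0. Qed.

Lemma harm_D k h i : harm k h -> harm k.-1 (D i h).
Proof.
case: k => [/harm0_D->|k [lh hh]]; first exact: harm0.
split; first by rewrite lap_D lh D0.
by have := hom_D i hh; rewrite -natr1 addrK.
Qed.

Lemma rotd0 i : rotd 0 i = 0 :> P.
Proof. by rewrite /rotd /crossv /gradv !D0 !mulr0 subr0. Qed.

Lemma harm_rotd k h i : harm k h -> harm k (rotd h i).
Proof. by move=> [lh hh]; split; [rewrite lap_rotd lh rotd0 | exact: hom_rotd]. Qed.

Lemma harm_divg k u : (forall i, harm k (u i)) -> harm k.-1 (divg u).
Proof. by move=> hu; rewrite /divg !(sum3 _ 0); do !apply: harmD; apply: harm_D. Qed.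

Definition odd_inv k : R := (2 * k%:R + 1)^-1.
Lemma odd_invE k : (odd_inv k)%:MP_[3] * (k%:R *+ 2 + 1) = 1.
Proof.
rewrite -mpolyC_nat -mpolyCMn -[X in _ + X]mpolyC1 -mpolyCD -mpolyCM /odd_inv mulr_natl.
by rewrite mulVf ?mpolyC1 //; apply: lt0r_neq0; have := ler0n R k; lra.
Qed.

Lemma dotvr0 u v : (forall i, v i = 0) -> dotv u v = 0.
Proof. by move=> hv; rewrite /dotv big1 // => i _; rewrite hv mulr0. Qed.

Lemma euler_divg_hom k u : (forall i, hom k%:R (u i)) -> euler (divg u) = (k%:R - 1)%:MP * divg u.
Proof.
move=> hu; rewrite euler_divg /divg mulr_sumr -sumrB; apply: eq_bigr => j _.
by rewrite hu DM DC; ring.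
Qed.

Lemma lap_divg u : lap (divg u) = divg (fun i => lap (u i)).
Proof.
rewrite {1}/divg /lap; under eq_bigr do rewrite !D_sum.
by rewrite exchange_big; apply: eq_bigr => i _; rewrite -[LHS]/(lap (D i (u i))) lap_D.
Qed.

(** The harmonic projection of x.u: its Laplacian is 2 div u, while that of
    |x|^2 div u is (4k + 2) div u, because div u is harmonic of degree k - 1. *)
Lemma harm_dotX k u : (forall i, harm k (u i)) ->
  harm k.+1 (dotv X u - (odd_inv k)%:MP * (sqnorm * divg u)).
Proof.
move=> hu; have hd := euler_divg_hom (fun i => (hu i).2).
have hl : lap (divg u) = 0.
  by rewrite lap_divg /divg big1 // => i _; rewrite (hu i).1 D0.
split.
  rewrite lapD lapN lapC lap_sqnorm hl hd lap_dotX dotvr0 => [|i]; last by case: (hu i).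
  rewrite mpolyCB mpolyC_nat.
  transitivity (divg u *+ 2 * (1 - (odd_inv k)%:MP * (k%:R *+ 2 + 1))); first by ring.
  by rewrite odd_invE subrr mulr0.
rewrite /hom eulerD eulerN eulerM eulerC euler_sqnorm hd euler_dotX.
rewrite (_ : dotv _ (fun i => euler (u i)) = k%:R%:MP * dotv X u).
  by rewrite !mpolyCB !mpolyC_nat; ring.
rewrite /dotv mulr_sumr; apply: eq_bigr => i _.
by case: (hu i) => _ ->; rewrite mulrCA.
Qed.

Definition single j p i : P := if i == j then p else 0.

Lemma divg_single j p : divg (single j p) = D j p.
Proof.
rewrite /divg (bigD1 j) //= /single eqxx big1 ?addr0 // => i /negPf->.
by rewrite D0.
Qed.

Lemma dotX_single j p : dotv X (single j p) = X j * p.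
Proof.
rewrite /dotv (bigD1 j) //= /single eqxx big1 ?addr0 // => i /negPf->.
by rewrite mulr0.
Qed.

Lemma harm_single k j p : harm k p -> forall i, harm k (single j p i).
Proof. by move=> hp i; rewrite /single; case: eqP => // _; apply: harm0. Qed.

(** On a sphere centred at the origin, a harmonic polynomial times a coordinate
    is therefore again a sum of harmonic ones. *)
Lemma harm_up k h i : harm k h ->
  harm k.+1 (X i * h - (odd_inv k)%:MP * (sqnorm * D i h)).
Proof.
by move=> hh; have := harm_dotX (harm_single i hh); rewrite dotX_single divg_single.
Qed.

Lemma mpoly_algind (Q : P -> Prop) :
  (forall c, Q c%:MP) -> (forall p q, Q p -> Q q -> Q (p + q)) ->
  (forall i p, Q p -> Q (X i * p)) -> forall p, Q p.
Proof.
move=> Qc Qd Qx; elim/mpolyind => [|c m p _ _ Qp]; first by rewrite -mpolyC0.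
apply: Qd => //; rewrite mpolyXE_id -mul_mpolyC -[_ * _]mulr1 -mulrA.
suff H (s : seq 'I_3) q : Q q -> Q (\prod_(i <- s) 'X_i ^+ m i * q).
  by rewrite mulrCA mulr1; apply: H.
move=> Qq; elim: s => [|i s IH]; first by rewrite big_nil mul1r.
rewrite big_cons -mulrA; elim: (m i) => [|l IHl]; first by rewrite mul1r.
by rewrite exprS -mulrA; apply: Qx.
Qed.

(** Polynomials that coincide on the sphere |x| = r with a sum of homogeneous
    harmonic ones.  As a predicate it is the induction principle by which
    statements pass from harmonic to arbitrary polynomials. *)
Inductive hspan (r : R) : P -> Prop :=
| hspan_harm k h of harm k h : hspan r h
| hspan_add p q of hspan r p & hspan r q : hspan r (p + q)
| hspan_mod q : hspan r ((sqnorm - (r ^+ 2)%:MP) * q).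

(** By harm_up the class is stable under multiplication by coordinates. *)
Lemma hspan_all r p : hspan r p.
Proof.
elim/mpoly_algind: p => [c|p q|i p].
- apply: (@hspan_harm _ 0); split; last exact: homC.
  by rewrite -[_%:MP]mulr1 lapC /lap big1 ?mulr0 // => i _; rewrite D1 D0.
- exact: hspan_add.
- elim=> [k h hh|{}p q _ hp _ hq|q].
  + pose b := (odd_inv k)%:MP * D i h.
    rewrite (_ : X i * h = X i * h - (odd_inv k)%:MP * (sqnorm * D i h)
             + ((r ^+ 2)%:MP * b + (sqnorm - (r ^+ 2)%:MP) * b)); last by rewrite /b; ring.
    apply: hspan_add; first exact/hspan_harm/harm_up/hh.
    apply: hspan_add (hspan_mod _ _).
    by apply/(@hspan_harm _ k.-1)/harmCM/harmCM/harm_D.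
  + by rewrite mulrDr; apply: hspan_add.
  + by rewrite mulrCA; apply: hspan_mod.
Qed.
End Harm.

(** * Explicit elastic fields and their boundary data *)

Section BoundaryData.
Context (R : realFieldType).
Local Notation P := {mpoly R[3]}.
Implicit Types (p q f g h : P) (i j : 'I_3) (u v F G : 'I_3 -> P) (a b c : R) (k : nat).
Local Notation X := (X R).
Local Notation sqnorm := (sqnorm R).
Context (lam mu r : R).

Definition lame_op u i : P := mu%:MP * lap (u i) + (lam + mu)%:MP * D i (divg u).
Definition elastic u := forall i, lame_op u i = 0.

(** On the sphere |x| = r this is r times the stress vector. *)
Definition traction u i : P :=
  (2 * mu)%:MP * euler (u i) + lam%:MP * (divg u * X i) + mu%:MP * crossv X (curlv u) i.

(** Only the first term is not determined, up to radial vectors, by the normal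
    displacement on the sphere. *)
Lemma tractionE u i : traction u i =
  mu%:MP * (euler (u i) - u i) + lam%:MP * (divg u * X i) + mu%:MP * D i (dotv X u).
Proof. by rewrite /traction crossX_curl; ring. Qed.

Lemma eq_divg u v : (forall i, u i = v i) -> divg u = divg v.
Proof. by move=> e; apply: eq_bigr => i _; rewrite e. Qed.
Lemma eq_dotX u v : (forall i, u i = v i) -> dotv X u = dotv X v.
Proof. by move=> e; apply: eq_bigr => i _; rewrite e. Qed.
Lemma eq_traction u v : (forall i, u i = v i) -> forall i, traction u i = traction v i.
Proof. by move=> e i; rewrite !tractionE e (eq_divg e) (eq_dotX e). Qed.

Definition lincomb a u b v i : P := a%:MP * u i + b%:MP * v i.

Lemma divg_lin a u b v : divg (lincomb a u b v) = a%:MP * divg u + b%:MP * divg v.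
Proof. rewrite /divg /lincomb !(sum3 _ 0) !DE; ring. Qed.
Lemma dotX_lin a u b v : dotv X (lincomb a u b v) = a%:MP * dotv X u + b%:MP * dotv X v.
Proof. rewrite /dotv /lincomb !(sum3 _ 0); ring. Qed.
Lemma lame_op_lin a u b v i :
  lame_op (lincomb a u b v) i = a%:MP * lame_op u i + b%:MP * lame_op v i.
Proof. rewrite /lame_op divg_lin /lincomb lapD !lapC !DE; ring. Qed.
Lemma traction_lin a u b v i :
  traction (lincomb a u b v) i = a%:MP * traction u i + b%:MP * traction v i.
Proof. rewrite !tractionE divg_lin dotX_lin /lincomb eulerD !eulerM !eulerC !DE; ring. Qed.

Definition sphere_poly : P := sqnorm - (r ^+ 2)%:MP.
(** Equality on the sphere, and equality of tangential parts on the sphere. *)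
Definition eqS p q := exists s, p = q + sphere_poly * s.
Definition tanS F G := exists g v, forall i, F i = G i + X i * g + sphere_poly * v i.

(** On the sphere, the displacement has normal component f / r and the stress
    vector has the tangential part of G / r. *)
Definition solves u f G :=
  [/\ elastic u, eqS (dotv X u) f & tanS (traction u) G].

Lemma solves_lin a u f F b v g G : solves u f F -> solves v g G ->
  solves (lincomb a u b v) (a%:MP * f + b%:MP * g) (lincomb a F b G).
Proof.
move=> [eu [s hs] [t [w hw]]] [ev [s' hs'] [t' [w' hw']]]; split.
- by move=> i; rewrite lame_op_lin eu ev !mulr0 addr0.
- by exists (a%:MP * s + b%:MP * s'); rewrite dotX_lin hs hs'; ring.
- exists (a%:MP * t + b%:MP * t'), (lincomb a w b w') => i.
  by rewrite traction_lin hw hw' /lincomb; ring.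
Qed.

Lemma solves_eq u f F g G : solves u f F -> eqS f g -> tanS F G -> solves u g G.
Proof.
move=> [eu [s hs] [t [w hw]]] [s' hs'] [t' [w' hw']]; split=> //.
- by exists (s + s'); rewrite hs hs'; ring.
- by exists (t + t'), (fun i => w i + w' i) => i; rewrite hw hw'; ring.
Qed.

Lemma eqS_refl p : eqS p p. Proof. by exists 0; rewrite mulr0 addr0. Qed.
Lemma tanS_refl F G : (forall i, F i = G i) -> tanS F G.
Proof. by move=> e; exists 0, (fun=> 0) => i; rewrite !mulr0 !addr0. Qed.

Lemma divg_sqnorm_grad p : divg (fun i => sqnorm * D i p) = euler p *+ 2 + sqnorm * lap p.
Proof. rewrite /sqnorm /divg /dotv /lap /euler !(sum3 _ 0).
have [[e1 e2 e3] [e4 e5 e6] [e7 e8 e9]] := DXE R 0.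
rewrite !DE ?(e1, e2, e3, e4, e5, e6, e7, e8, e9); ring. Qed.

Lemma euler_harm k h : harm k h -> euler h = k%:R%:MP * h. Proof. by case. Qed.
Lemma euler_Dharm k h i : harm k h -> euler (D i h) = (k%:R - 1)%:MP * D i h.
Proof. by case=> _ /(hom_D i). Qed.

(** The traction vanishes for k = 1, when the field is a rigid rotation. *)
Lemma solves_rotd k h : harm k h ->
  solves (rotd h) 0 (fun i => (mu * (k%:R - 1))%:MP * rotd h i).
Proof.
move=> hh; split.
- by move=> i; rewrite /lame_op divg_rotd D0 mulr0 addr0 (harm_rotd i hh).1 mulr0.
- by rewrite dotX_rotd; apply: eqS_refl.
- apply: tanS_refl => i; rewrite tractionE divg_rotd dotX_rotd D0 (euler_harm (harm_rotd i hh)).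
  by ring.
Qed.

Lemma solves_grad k h : harm k h ->
  solves (gradv h) (k%:R%:MP * h) (fun i => (2 * mu * (k%:R - 1))%:MP * D i h).
Proof.
move=> hh; split.
- by move=> i; rewrite /lame_op divg_grad hh.1 D0 /gradv lap_D hh.1 D0 !mulr0 addr0.
- by rewrite dotX_grad hh.2; apply: eqS_refl.
- apply: tanS_refl => i; rewrite tractionE divg_grad hh.1 dotX_grad hh.2 (euler_Dharm i hh).
  by rewrite /gradv !DE; ring.
Qed.

Context (hmu : 0 < mu) (hlam : 0 < 3 * lam + 2 * mu) (hr : 0 < r).

(** The factor for which the field quad below is annihilated by the Lame
    operator, all terms being proportional to grad h. *)
Definition quad_coef k : R :=
  - (mu * (4 * k%:R + 2) + 2 * k%:R * (lam + mu)) / (2 * mu + (lam + mu) * (k%:R + 3)).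

Lemma lammu_gt0 : 0 < lam + mu. Proof. by move: hmu hlam; lra. Qed.
Lemma quad_coef_den k : 0 < 2 * mu + (lam + mu) * (k%:R + 3).
Proof.
have := hmu; have := mulr_ge0 (ltW lammu_gt0) (ler0n R k); have := lammu_gt0; nra.
Qed.
Lemma quad_coefE k :
  mu * (4 * k%:R + 2 + 2 * quad_coef k) + (lam + mu) * (2 * k%:R + quad_coef k * (k%:R + 3)) = 0.
Proof. rewrite /quad_coef; field. exact: lt0r_neq0 (quad_coef_den k). Qed.

Definition quad k h i : P := sqnorm * D i h + (quad_coef k)%:MP * (X i * h).

Lemma solves_quad k h : harm k h ->
  solves (quad k h) ((r ^+ 2 * (k%:R + quad_coef k))%:MP * h)
         (fun i => (mu * r ^+ 2 * (2 * k%:R + quad_coef k))%:MP * D i h).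
Proof.
move=> hh; have hd : divg (quad k h) = (2 * k%:R + quad_coef k * (k%:R + 3))%:MP * h.
  transitivity (divg (lincomb 1 (fun i => sqnorm * D i h) (quad_coef k) (fun i => X i * h))).
    by apply: eq_divg => i; rewrite /lincomb mpolyC1 mul1r.
  by rewrite divg_lin divg_sqnorm_grad divg_X hh.1 hh.2; ring.
have hx : dotv X (quad k h) = (k%:R + quad_coef k)%:MP * (sqnorm * h).
  transitivity (dotv X (lincomb 1 (fun i => sqnorm * D i h) (quad_coef k) (fun i => X i * h))).
    by apply: eq_dotX => i; rewrite /lincomb mpolyC1 mul1r.
  rewrite dotX_lin (_ : dotv X (fun i => sqnorm * D i h) = sqnorm * euler h).
    rewrite hh.2 (_ : dotv X (fun i => X i * h) = sqnorm * h); first by ring.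
    by rewrite /sqnorm /dotv mulr_suml; apply: eq_bigr => i _; rewrite mulrA.
  by rewrite /euler mulr_sumr; apply: eq_bigr => i _; rewrite mulrCA.
have hl i : lap (quad k h i) = (4 * k%:R + 2 + 2 * quad_coef k)%:MP * D i h.
  rewrite /quad lapD lapC lap_X lap_sqnorm lap_D hh.1 D0 (euler_Dharm i hh); ring.
split.
- move=> i; rewrite /lame_op hd hl DM DC.
  transitivity ((mu * (4 * k%:R + 2 + 2 * quad_coef k) +
    (lam + mu) * (2 * k%:R + quad_coef k * (k%:R + 3)))%:MP * D i h); first by ring.
  by rewrite quad_coefE mul0r.
- by exists ((k%:R + quad_coef k)%:MP * h); rewrite hx /sphere_poly; ring.
- exists (lam%:MP * (2 * k%:R + quad_coef k * (k%:R + 3))%:MP * h +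
    (mu * (k%:R * quad_coef k + 2 * (k%:R + quad_coef k)))%:MP * h),
    (fun i => (mu * (2 * k%:R + quad_coef k))%:MP * D i h) => i.
  rewrite tractionE hd hx {1}/quad !DM !DC eulerD euler_sqnorm !eulerM !eulerC (euler_Dharm i hh) hh.2 eulerX.
  rewrite D_sqnorm.
  by rewrite /quad /sphere_poly; ring.
Qed.
End BoundaryData.

(** * Polynomial data: normal displacement *)

Section NormalProblem.
Context (R : realFieldType).
Local Notation P := {mpoly R[3]}.
Implicit Types (p q f g h : P) (i j : 'I_3) (u v F G : 'I_3 -> P) (a b c : R) (k : nat).
Local Notation X := (X R).
Local Notation sqnorm := (sqnorm R).
Context (lam mu r : R).
Context (hmu : 0 < mu) (hlam : 0 < 3 * lam + 2 * mu) (hr : 0 < r).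
Local Notation solves := (solves lam mu r).
Local Notation quad_coef := (quad_coef lam mu).
Local Notation tanS := (tanS r).
Local Notation eqS := (eqS r).

(** Up to the factor mu r^2, the determinant of the data of gradv h and quad h
    with respect to (h, 0) and (0, grad h).  For k = 1 it is a positive
    multiple of 3 lam + 2 mu; for larger k both terms are nonnegative, as
    quad_coef is negative. *)
Lemma det_gt0 k : (0 < k)%N -> 0 < 2 * k%:R + quad_coef k * (2 - k%:R).
Proof.
case: k => // -[_|k _].
  rewrite /quad_coef -[ltRHS](_ : 2 * (3 * lam + 2 * mu) / (2 * mu + (lam + mu) * (1 + 3)) = _).
    by rewrite divr_gt0 ?mulr_gt0 //; have := quad_coef_den hmu hlam 1.
  by field; have := quad_coef_den hmu hlam 1; apply: lt0r_neq0.
have ha : quad_coef k.+2 < 0.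
  rewrite /quad_coef mulNr oppr_lt0 divr_gt0 ?quad_coef_den //.
  have := mulr_ge0 (ltW (lammu_gt0 hmu hlam)) (ler0n R k.+2).
  have := mulr_ge0 (ltW hmu) (ler0n R k.+2); move: hmu; nra.
have hk : 0 <= k%:R :> R by [].
have e : k.+2%:R = k%:R + 2 :> R by rewrite -addn2 natrD.
rewrite e; have := mulr_le0_ge0 (ltW ha) hk; move: hk; nra.
Qed.

Definition solvable f F := exists u, solves u f F.

Lemma solvesW u f F : solves u f F -> solvable f F.
Proof. by exists u. Qed.

Lemma solvable_lin a f F b g G : solvable f F -> solvable g G ->
  solvable (a%:MP * f + b%:MP * g) (lincomb a F b G).
Proof. by move=> [u hu] [v hv]; exists (lincomb a u b v); apply: solves_lin. Qed.
Lemma solvable_eq f F g G : solvable f F -> eqS f g -> tanS F G -> solvable g G.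
Proof. by move=> [u hu] hf hF; exists u; apply: solves_eq hu hf hF. Qed.
Lemma eqS_eq p q : p = q -> eqS p q.
Proof. by move=> ->; apply: eqS_refl. Qed.

Lemma solves0 : solves (fun=> 0) 0 (fun=> 0).
Proof.
have dv0 : divg (fun=> 0) = 0 :> P by rewrite /divg big1 // => i _; rewrite D0.
have dot0 : dotv X (fun=> 0) = 0 :> P by apply: dotvr0.
split=> [i||].
- by rewrite /lame_op dv0 lap0 D0 !mulr0 addr0.
- exact: eqS_eq.
- by apply: tanS_refl => i; rewrite tractionE dv0 dot0 D0 -mpolyC0 eulerC; ring.
Qed.

Lemma solvable_harm_pos k h : (0 < k)%N -> harm k h ->
  solvable h (fun=> 0) /\ solvable 0 (gradv h).
Proof.
move=> k0 hh.
have s1 := solvesW (solves_grad lam mu r hh).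
have s2 := solvesW (solves_quad r hmu hlam hh).
have d0 := lt0r_neq0 (det_gt0 k0); have m0 := lt0r_neq0 hmu; have r0 := lt0r_neq0 hr.
(* The coefficients below are those of Cramer's rule. *)
pose d := mu * r ^+ 2 * (2 * k%:R + quad_coef k * (2 - k%:R)).
have hd : d != 0 by rewrite !mulf_neq0 ?expf_neq0.
split.
- apply: solvable_eq (solvable_lin (mu * r ^+ 2 * (2 * k%:R + quad_coef k) / d) (- (2 * mu * (k%:R - 1)) / d) s1 s2) _ _.
  + apply: eqS_eq; transitivity (((mu * r ^+ 2 * (2 * k%:R + quad_coef k) / d) * k%:R +
      (- (2 * mu * (k%:R - 1)) / d) * (r ^+ 2 * (k%:R + quad_coef k)))%:MP * h); first by ring.
    rewrite [X in X%:MP_[3]](_ : _ = d * d^-1); first by rewrite divff // mpolyC1 mul1r.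
    by move: d^-1 => e; rewrite /d; ring.
  + by apply: tanS_refl => i; rewrite /lincomb; ring.
- apply: solvable_eq (solvable_lin (- (r ^+ 2 * (k%:R + quad_coef k)) / d) (k%:R / d) s1 s2) _ _.
  + by apply: eqS_eq; ring.
  + apply: tanS_refl => i; rewrite /lincomb /gradv.
    transitivity (((k%:R / d) * (mu * r ^+ 2 * (2 * k%:R + quad_coef k)) +
      (- (r ^+ 2 * (k%:R + quad_coef k)) / d) * (2 * mu * (k%:R - 1)))%:MP * D i h); first by ring.
    rewrite [X in X%:MP_[3]](_ : _ = d * d^-1); first by rewrite divff // mpolyC1 mul1r.
    by move: d^-1 => e; rewrite /d; ring.
Qed.

Lemma quad_coef0_neq0 : quad_coef 0 != 0.
Proof.
rewrite /quad_coef mulf_neq0 ?oppr_eq0 ?invr_neq0 ?lt0r_neq0 //; last exact: quad_coef_den.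
by move: hmu; lra.
Qed.

Lemma solvable_harm k h : harm k h -> solvable h (fun=> 0).
Proof.
case: k => [|k] hh; last by have [] := solvable_harm_pos (ltn0Sn _) hh.
have s2 := solvesW (solves_quad r hmu hlam hh).
have s0 := solvesW solves0.
apply: solvable_eq (solvable_lin (r ^+ 2 * quad_coef 0)^-1 0 s2 s0) _ _.
- apply: eqS_eq; rewrite mulr0 addr0 mulrA -mpolyCM add0r mulVf ?mpolyC1 ?mul1r //.
  by rewrite mulf_neq0 ?expf_neq0 ?quad_coef0_neq0 ?lt0r_neq0.
- by apply: tanS_refl => i; rewrite /lincomb (harm0_D i hh); ring.
Qed.

Lemma solvable_gradv k h : harm k h -> solvable 0 (gradv h).
Proof.
case: k => [|k] hh; last by have [] := solvable_harm_pos (ltn0Sn _) hh.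
apply: solvable_eq (solvesW solves0) (eqS_refl _ _) _.
by apply: tanS_refl => i; rewrite /gradv (harm0_D i hh).
Qed.

Lemma solvable_normal f : solvable f (fun=> 0).
Proof.
elim: (hspan_all r f) => [k h|p q _ hp _ hq|q]; first exact: solvable_harm.
- apply: solvable_eq (solvable_lin 1 1 hp hq) _ _.
    by apply: eqS_eq; rewrite mpolyC1 !mul1r.
  by apply: tanS_refl => i; rewrite /lincomb; ring.
- apply: solvable_eq (solvesW solves0) _ (tanS_refl _ _) => //.
  by exists (- q); rewrite /sphere_poly; ring.
Qed.

(** The defect x /\ c is the toroidal field of degree one: no elastic field
    has it as its traction. *)
Definition tsolvable F := exists c : 'I_3 -> R, solvable 0 (fun i => F i + crossv X (fun j => (c j)%:MP) i).

Lemma tsolvable_lin a F b G : tsolvable F -> tsolvable G -> tsolvable (lincomb a F b G).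
Proof.
move=> [c hF] [d hG]; exists (fun i => a * c i + b * d i).
apply: solvable_eq (solvable_lin a b hF hG) _ _; first by apply: eqS_eq; ring.
by apply: tanS_refl => i; rewrite /lincomb /crossv; ring.
Qed.
Lemma tsolvable_eq F G : tsolvable F -> tanS F G -> tsolvable G.
Proof.
move=> [c hF] [t [w hw]]; exists c; apply: solvable_eq hF (eqS_refl _ _) _.
by exists t, w => i; rewrite hw; ring.
Qed.
Lemma solvable_tsolvable F : solvable 0 F -> tsolvable F.
Proof.
move=> hF; exists (fun=> 0); apply: solvable_eq hF (eqS_refl _ _) _.
by apply: tanS_refl => i; rewrite /crossv; ring.
Qed.

Lemma tsolvable_rotd k h : harm k h -> tsolvable (rotd h).
Proof.
move=> hh; case: k => [|[|k]] in hh *.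
- apply: tsolvable_eq (solvable_tsolvable (solvesW solves0)) _.
  by apply: tanS_refl => i; rewrite /rotd /crossv /gradv !(harm0_D _ hh); ring.
- exists (fun i => - (D i h)@_0); apply: solvable_eq (solvesW solves0) (eqS_refl _ _) _.
  apply: tanS_refl => i; rewrite /rotd /crossv /gradv.
  have e j : D j h = ((D j h)@_0)%:MP by apply: hom0_const; case: (harm_D j hh).
  rewrite {1}(e (i + 2)) {1}(e (i + 1)); ring.
- apply: solvable_tsolvable; have s1 := solvesW (solves_rotd lam mu r hh).
  have m0 : mu * (k.+2%:R - 1) != 0.
    by rewrite mulf_neq0 ?(lt0r_neq0 hmu) // -natr1 addrK pnatr_eq0.
  apply: solvable_eq (solvable_lin (mu * (k.+2%:R - 1))^-1 0 s1 s1) _ _.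
    by apply: eqS_eq; ring.
  apply: tanS_refl => i; rewrite /lincomb mulrA -mpolyCM mulVf // mpolyC1; ring.
Qed.
End NormalProblem.

(** * Polynomial data: tangential traction *)

Section TangentialProblem.
Context (R : realFieldType).
Local Notation P := {mpoly R[3]}.
Implicit Types (p q f g h : P) (i j : 'I_3) (u v w F G : 'I_3 -> P) (a b c : R) (k : nat).
Local Notation X := (X R).
Local Notation sqnorm := (sqnorm R).

Lemma harm_curl k u : (forall j, harm k (u j)) -> forall i, harm k.-1 (curlv u i).
Proof.
move=> hu i; rewrite /curlv -[- _]mul1r mulrN -mulNr -(mpolyC1 3) -mpolyCN.
by apply: harmD; [|apply: harmCM]; apply: harm_D.
Qed.

(** Splitting of a harmonic field into gradient, toroidal and radial parts.
    The identity x /\ curl u = grad (x.u) - (k + 1) u is applied first to u,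
    then to curl u, whose curl is grad div u. *)
Lemma harm_vec_decomp k u i : (forall j, harm k (u j)) ->
  (k%:R * (k%:R + 1))%:MP * u i =
  k%:R%:MP * D i (dotv X u) - rotd (dotv X (curlv u)) i
  + (k%:R - 1)%:MP * (X i * divg u) - sqnorm * D i (divg u).
Proof.
move=> hu; set d := divg u; set C := curlv u; set t := dotv X C.
have hd : euler d = (k%:R - 1)%:MP * d := euler_divg_hom (fun j => (hu j).2).
have hC j : k%:R%:MP * C j = D j t - rotd d j.
  have e : euler (C j) = (k%:R - 1)%:MP * C j.
    rewrite euler_curl /C /curlv !(hu _).2 !DM !DC; ring.
  have := crossX_curl C j; rewrite -/t e.
  rewrite (_ : crossv X (curlv C) j = rotd d j); first by move=> ->; ring.
  by rewrite /rotd /crossv /gradv !curl_curl !(hu _).1 !subr0.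
have h1 := crossX_curl u i; rewrite -/C (hu i).2 in h1.
have h2 : k%:R%:MP * crossv X C i = rotd t i - (X i * euler d - sqnorm * D i d).
  rewrite -crossXX_grad /rotd /crossv /gradv mulrBr ![k%:R%:MP * (_ * _)]mulrCA !hC.
  by rewrite /rotd /crossv /gradv; ring.
move: h2; rewrite h1 hd => h2.
transitivity (k%:R%:MP * D i (dotv X u) - k%:R%:MP * (D i (dotv X u) - u i - k%:R%:MP * u i)).
  by ring.
by rewrite h2; ring.
Qed.

Context (lam mu r : R).
Context (hmu : 0 < mu) (hlam : 0 < 3 * lam + 2 * mu) (hr : 0 < r).
Local Notation tsolvable := (tsolvable lam mu r).
Local Notation solvable := (solvable lam mu r).

Lemma tsolvable_gradv k h : harm k h -> tsolvable (gradv h).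
Proof. by move=> hh; apply/solvable_tsolvable/(solvable_gradv hmu hlam hr hh). Qed.

(** In harm_vec_decomp the radial term has no tangential part, |x|^2 is r^2,
    and x.u is replaced by its harmonic part g, which changes the gradient by
    a multiple of grad div u. *)
Lemma tsolvable_harm k u : (forall j, harm k (u j)) -> tsolvable u.
Proof.
move=> hu; have hg := harm_dotX hu.
have hd := harm_divg hu.
case: k => [|k] in hu hg hd *.
  apply: tsolvable_eq (tsolvable_gradv hg) _; apply: tanS_refl => i.
  have D0u j l : D j (u l) = 0 by apply: harm0_D.
  have d0 : divg u = 0 by rewrite /divg big1.
  have := crossX_curl u i; rewrite /crossv /curlv !D0u (hu i).2 !subrr !mulr0 subrr.
  rewrite /gradv d0 !mulr0 subr0 mpolyC0 mul0r subr0 => /esym/eqP.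
  by rewrite subr_eq0 => /eqP.
have ht : harm k.+1 (dotv X (curlv u)).
  have := harm_dotX (harm_curl hu); by rewrite divg_curl !mulr0 subr0.
pose A : R := (k.+1%:R + 1)^-1; pose C : R := (k.+1%:R * (k.+1%:R + 1))^-1.
pose B : R := r ^+ 2 * (k.+1%:R * odd_inv R k.+1 - 1) * C.
have hAC : A = C * k.+1%:R by rewrite /A /C invfM mulrAC mulVf ?pnatr_eq0 ?mul1r.
have s1 := tsolvable_lin B 1 (tsolvable_gradv hd)
  (tsolvable_lin A (- C) (tsolvable_gradv hg) (tsolvable_rotd _ _ hmu ht)).
apply: tsolvable_eq s1 _.
have hC : C * (k.+1%:R * (k.+1%:R + 1)) = 1.
  by rewrite mulVf // mulf_neq0 // ?natr1 pnatr_eq0.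
exists ((- C * (k.+1%:R - 1) - C * k.+1%:R * odd_inv R k.+1 * 2)%:MP * divg u),
  (fun i => (- (C * (k.+1%:R * odd_inv R k.+1 - 1)))%:MP * D i (divg u)) => i.
have -> : u i = C%:MP * ((k.+1%:R * (k.+1%:R + 1))%:MP * u i).
  by rewrite mulrA -mpolyCM hC mpolyC1 mul1r.
rewrite (harm_vec_decomp i hu).
rewrite /lincomb /gradv Dadd Dopp !DM DC D_sqnorm hAC /B /sphere_poly mpolyC1; ring.
Qed.

Lemma tsolvable_all F : tsolvable F.
Proof.
have H j p : tsolvable (single j p).
  elim: (hspan_all r p) => [k h hh|{}p q _ hp _ hq|q].
  - by apply: (@tsolvable_harm k) => l; apply: harm_single.
  - apply: tsolvable_eq (tsolvable_lin 1 1 hp hq) _; apply: tanS_refl => i.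
    by rewrite /lincomb /single; case: eqP => _; rewrite mpolyC1; ring.
  - apply: tsolvable_eq (solvable_tsolvable (solvesW (solves0 lam mu r))) _.
    exists 0, (single j (- q)) => i.
    by rewrite /single; case: eqP => _; rewrite /sphere_poly; ring.
have := tsolvable_lin 1 1 (H 0 (F 0)) (tsolvable_lin 1 1 (H (0 + 1) (F (0 + 1))) (H (0 + 2) (F (0 + 2)))).
move/tsolvable_eq; apply; apply: tanS_refl => i; rewrite /lincomb /single mpolyC1.
by have [->|->|->] := ord3_cases i; rewrite ?(eqxx, ord3_eqF); ring.
Qed.
End TangentialProblem.

(** * Rotational sums and the structure of elastic fields *)

Section ElasticFields.
Context (R : realFieldType).
Local Notation P := {mpoly R[3]}.
Implicit Types (p q f g h : P) (i j : 'I_3) (u v w F G : 'I_3 -> P) (a c : R) (b : 'I_3 -> R) (k : nat).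
Local Notation X := (X R).
Local Notation sqnorm := (sqnorm R).

(** The range of the infinitesimal rotations.  Its elements have mean zero over
    every sphere centred at the origin. *)
Definition rotsum p := exists g : 'I_3 -> P, p = \sum_i rotd (g i) i.

Lemma rotdD p q i : rotd (p + q) i = rotd p i + rotd q i.
Proof. by rewrite /rotd /crossv /gradv !Dadd; ring. Qed.
Lemma rotdCM c p i : rotd (c%:MP * p) i = c%:MP * rotd p i.
Proof. by rewrite /rotd /crossv /gradv !DM !DC; ring. Qed.
Lemma rotdN p i : rotd (- p) i = - rotd p i.
Proof. by rewrite /rotd /crossv /gradv !Dopp; ring. Qed.

Lemma rotsumD p q : rotsum p -> rotsum q -> rotsum (p + q).
Proof.
move=> [g ->] [h ->]; exists (fun i => g i + h i).
by rewrite -big_split; apply: eq_bigr => i _; rewrite rotdD.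
Qed.
Lemma rotsumCM c p : rotsum p -> rotsum (c%:MP * p).
Proof.
move=> [g ->]; exists (fun i => c%:MP * g i).
by rewrite mulr_sumr; apply: eq_bigr => i _; rewrite rotdCM.
Qed.
Lemma rotsum0 : rotsum 0.
Proof. by exists (fun=> 0); rewrite big1 // => i _; rewrite rotd0. Qed.

(** By rotd_rotd a harmonic polynomial is an eigenvector of the angular
    Laplacian, with a nonzero eigenvalue in positive degree. *)
Lemma rotsum_harm k h : harm k.+1 h -> rotsum h.
Proof.
move=> hh; have n0 : - (k.+1%:R * (k.+1%:R + 1)) != 0 :> R.
  by rewrite oppr_eq0 mulf_neq0 // ?natr1 pnatr_eq0.
rewrite -[h]mul1r -(mpolyC1 3) -(mulVf n0) mpolyCM -mulrA; apply: rotsumCM.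
exists (rotd h); rewrite rotd_rotd hh.1 hh.2 eulerM eulerC hh.2; ring.
Qed.

(** Green's formula for the angular Laplacian: harmonic polynomials of degree k
    and 1 are orthogonal on the sphere, unless the factor vanishes. *)
Lemma rotsum_harmM k p q : harm k p -> harm 1 q ->
  rotsum ((2 - k%:R * (k%:R + 1))%:MP * (p * q)).
Proof.
move=> hp hq; exists (fun i => rotd p i * q - p * rotd q i).
transitivity ((\sum_i rotd (rotd p i) i) * q - p * \sum_i rotd (rotd q i) i).
  by rewrite !rotd_rotd hp.1 hq.1 hp.2 hq.2 !eulerM !eulerC hp.2 hq.2; ring.
rewrite mulr_suml mulr_sumr -sumrB; apply: eq_bigr => i _.
by rewrite (rotdD (rotd p i * q)) rotdN (rotdM (rotd p i)) (rotdM p); ring.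
Qed.

Definition rigid b i : P := crossv (fun j => (b j)%:MP) X i.

Lemma lap1 : lap 1 = 0 :> P.
Proof. by rewrite /lap big1 // => l _; rewrite D1 D0. Qed.
Lemma lapX i : lap (X i) = 0.
Proof. by rewrite -[X i]mulr1 lap_X lap1 D1 mulr0 mul0rn addr0. Qed.

Lemma harm_rigid b i : harm 1 (rigid b i).
Proof.
rewrite /rigid /crossv -mulNr -mpolyCN.
have hX j : harm 1 (X j).
  by split; [exact: lapX | exact: homX].
by apply: harmD; apply: harmCM.
Qed.

Lemma dotX_rigid g b : dotv (fun i => X i * g) (rigid b) = 0.
Proof. by rewrite /dotv /rigid /crossv (sum3 _ 0) !ord3E; ring. Qed.

Lemma grad_rigid p b : dotv (gradv p) (rigid b) = \sum_i (b i)%:MP * rotd p i.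
Proof. by rewrite /dotv /rigid /rotd /crossv /gradv !(sum3 _ 0) !ord3E; ring. Qed.

Lemma rotsum_grad_rigid p b : rotsum (dotv (gradv p) (rigid b)).
Proof.
rewrite grad_rigid; exists (fun i => (b i)%:MP * p).
by apply: eq_bigr => i _; rewrite rotdCM.
Qed.

Lemma dotv_lin a u c v w : dotv (lincomb a u c v) w = a%:MP * dotv u w + c%:MP * dotv v w.
Proof. rewrite /dotv /lincomb !(sum3 _ 0); ring. Qed.
Lemma eq_dotvl u v w : (forall i, u i = v i) -> dotv u w = dotv v w.
Proof. by move=> e; apply: eq_bigr => i _; rewrite e. Qed.

(** The polynomial is harmonic of degree two. *)
Lemma rotsum_XX i j : rotsum (X i * X j - ((i == j)%:R / 3)%:MP * sqnorm).
Proof.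
apply: (@rotsum_harm 1); split; last first.
  apply: homD; first exact: (homM (homX R i) (homX R j)).
  by apply: homN; apply: homCM; apply: hom_sqnorm.
rewrite lapD lapN lapC lap_X lapX mulr0 add0r -[sqnorm]mulr1 lap_sqnorm lap1 (eulerC 1).
rewrite DX mul0rn mulr0 !addr0.
transitivity (((i == j)%:R * 2 - (i == j)%:R / 3 * 6)%:MP_[3] : P).
  by case: (i == j); ring.
by rewrite (_ : _ - _ = 0) ?mpolyC0 //; field.
Qed.

Context (lam mu : R).
Context (hmu : 0 < mu) (hlam : 0 < 3 * lam + 2 * mu).
Local Notation lame_op := (lame_op lam mu).
Local Notation elastic := (elastic lam mu).
Local Notation traction := (traction lam mu).

Definition elastic_coef k : R := - ((lam + mu) / (2 * (lam * (k%:R - 1) + mu * (3 * k%:R - 2)))).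
(** For w = omega e_j this is the vector of the system attached to omega
    and j. *)
Definition elastic_field k w i : P := w i + (elastic_coef k)%:MP * (sqnorm * D i (divg w)).

Lemma elastic_coef_den k : lam * (k%:R - 1) + mu * (3 * k%:R - 2) != 0.
Proof.
case: k => [|k]; first by apply/ltr0_neq0; move: hmu hlam; lra.
apply/lt0r_neq0; rewrite -natr1 addrK.
have := mulr_ge0 (ltW hlam) (ler0n R k); have := mulr_ge0 (ltW hmu) (ler0n R k); move: hmu; nra.
Qed.
Lemma four_k_minus2_neq0 k : 4 * k%:R - 2 != 0 :> R.
Proof.
case: k => [|k]; first by apply/ltr0_neq0; lra.
apply/lt0r_neq0; rewrite -natr1; have := ler0n R k; lra.
Qed.

Lemma elastic_fieldE k w : forall i, elastic_field k w i = lincomb 1 w (elastic_coef k) (fun i => sqnorm * D i (divg w)) i.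
Proof. by move=> i; rewrite /lincomb mpolyC1 mul1r. Qed.

Lemma elastic_elastic_field k w : (forall i, harm k (w i)) -> elastic (elastic_field k w).
Proof.
move=> hw i; set d := divg w.
have hd : euler d = (k%:R - 1)%:MP * d by apply: euler_divg_hom => j; case: (hw j).
have ld : lap d = 0 by rewrite lap_divg /divg big1 // => j _; rewrite (hw j).1 D0.
rewrite /lame_op (eq_divg (elastic_fieldE k w)) divg_lin divg_sqnorm_grad -/d ld hd /elastic_field -/d.
rewrite lapD lapC lap_sqnorm (hw i).1 lap_D ld euler_D hd D0 !DE.
transitivity ((mu * elastic_coef k * (4 * k%:R - 2) + (lam + mu) * (1 + 2 * elastic_coef k * (k%:R - 1)))%:MP * D i d).
  by ring.
by rewrite [X in X%:MP_[3]](_ : _ = 0) ?mpolyC0 ?mul0r // /elastic_coef; field; exact: elastic_coef_den.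
Qed.

(** As div u is harmonic and the Laplacian of u is a multiple of grad div u,
    subtracting from u a suitable multiple of |x|^2 grad div u leaves a
    harmonic field w, and div w is a multiple of div u. *)
Lemma hom_elastic_field k u : (forall i, hom k%:R (u i)) -> elastic u ->
  exists2 w, (forall i, harm k (w i)) & forall i, u i = elastic_field k w i.
Proof.
move=> hu eu; set d := divg u; have hd : euler d = (k%:R - 1)%:MP * d by apply: euler_divg_hom.
have m0 := lt0r_neq0 hmu; have k0 := four_k_minus2_neq0 k; have L0 := elastic_coef_den k.
have ld : lap d = 0.
  have : divg (lame_op u) = (lam + 2 * mu)%:MP * lap d.
    transitivity (mu%:MP * divg (fun i => lap (u i)) + (lam + mu)%:MP * lap d).
      by rewrite /lame_op -divg_grad -divg_lin.
    by rewrite -lap_divg; ring.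
  rewrite (_ : divg _ = 0) => [/esym/eqP|]; last by rewrite /divg big1 // => i _; rewrite eu D0.
  rewrite mulf_eq0 mpolyC_eq0 => /orP[/eqP e|/eqP//]; exfalso; move: hmu hlam e; lra.
have lu i : lap (u i) = (- ((lam + mu) / mu))%:MP * D i d.
  have := eu i; rewrite /lame_op -/d => /(congr1 (fun q => (mu^-1)%:MP * q)).
  rewrite mulrDr mulrA -mpolyCM mulVf // mpolyC1 mul1r mulr0 => /eqP.
  by rewrite addr_eq0 => /eqP ->; ring.
pose c := - ((lam + mu) / (mu * (4 * k%:R - 2))).
pose w i := u i - c%:MP * (sqnorm * D i d).
have hw i : harm k (w i).
  split.
    rewrite /w lapD lapN lapC lap_sqnorm lu lap_D ld D0 euler_D hd DM DC.
    transitivity ((- ((lam + mu) / mu) - c * (4 * k%:R - 2))%:MP * D i d); first by ring.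
    by rewrite [X in X%:MP_[3]](_ : _ = 0) ?mpolyC0 ?mul0r // /c; field; rewrite m0 k0.
  apply: homD => //; apply/homN/homCM; rewrite (_ : k%:R = 2 + (k%:R - 2)); last by ring.
  apply: homM; first exact: hom_sqnorm.
  by rewrite /hom euler_D hd DM DC; ring.
exists w => // i; have dw : divg w = (1 - 2 * c * (k%:R - 1))%:MP * d.
  transitivity (divg (lincomb 1 u (- c) (fun i => sqnorm * D i d))).
    by apply: eq_divg => j; rewrite /w /lincomb mpolyC1; ring.
  by rewrite divg_lin divg_sqnorm_grad hd ld -/d; ring.
rewrite /elastic_field dw /w DM DC.
transitivity (u i + (elastic_coef k * (1 - 2 * c * (k%:R - 1)) - c)%:MP * (sqnorm * D i d)); last by ring.
rewrite [X in X%:MP_[3]](_ : _ = 0) ?mpolyC0 ?mul0r ?addr0 // /elastic_coef /c; field.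
by rewrite m0 k0 L0.
Qed.

Lemma hcomp_sumv u : exists n, forall j, u j = \sum_(l < n) hcomp l (u j).
Proof.
exists (\max_j mmeasure (@mdeg _) (u j)) => j.
by apply: hcomp_sum; exact: (leq_bigmax (F := fun j => mmeasure (@mdeg _) (u j))).
Qed.

Lemma elastic_hcomp n u : (forall i, u i = \sum_(l < n) hcomp l (u i)) ->
  elastic u ->
  forall k : 'I_n, elastic (fun j => hcomp k (u j)).
Proof.
move=> un eu k i; move: k; apply: (@hom_sum_eq0 _ n 2) => [l|].
  rewrite /lame_op; apply: homD; apply: homCM; first exact/hom_lap/hom_hcomp.
  rewrite (_ : _ - 2 = l%:R - 1 - 1); last by ring.
  by apply: hom_D; rewrite /hom; apply: euler_divg_hom => j; apply: hom_hcomp.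
rewrite -[RHS](eu i) /lame_op.
have -> : lap (u i) = \sum_(l < n) lap (hcomp l (u i)).
  by rewrite {1}(un i) (big_morph _ (@lapD R) (lap0 R)).
have -> : divg u = \sum_(l < n) divg (fun j => hcomp l (u j)).
  rewrite /divg exchange_big; apply: eq_bigr => j _.
  by rewrite {1}(un j) D_sum.
by rewrite D_sum !mulr_sumr -big_split.
Qed.

(** The Lame operator lowers degrees by exactly two, so the homogeneous
    components of an elastic field are elastic, and hom_elastic_field applies
    to each of them. *)
Lemma elastic_ind (Q : ('I_3 -> P) -> Prop) :
  (forall u v, (forall i, u i = v i) -> Q u -> Q v) ->
  (forall u v, Q u -> Q v -> Q (fun i => u i + v i)) ->
  (forall k w, (forall i, harm k (w i)) -> Q (elastic_field k w)) ->
  forall u, elastic u -> Q u.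
Proof.
move=> Qe Qa Qh u eu; have [n un] := hcomp_sumv u.
have {}eu := elastic_hcomp un eu.
apply: (Qe _ _ (fun i => esym (un i))).
have Q0 : Q (fun=> 0).
  apply: (Qe (elastic_field 0 (fun=> 0))) => [i|]; last by apply: Qh => i; apply: harm0.
  by rewrite /elastic_field /divg big1 ?D0 ?mulr0 ?addr0 // => j _; rewrite D0.
elim: (index_enum _) => [|l s IH].
  by apply: (Qe (fun=> 0)) => // i; rewrite big_nil.
apply: (Qe _ _ _ (Qa (fun i => hcomp l (u i)) _ _ IH)) => [i|]; first by rewrite big_cons.
have [w hw uw] := hom_elastic_field (fun i => hom_hcomp l (u i)) (eu l).
by apply: (Qe _ _ (fun i => esym (uw i))); apply: Qh.
Qed.

Lemma rotsum_sum (I : Type) (s : seq I) (F : I -> P) :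
  (forall l, rotsum (F l)) -> rotsum (\sum_(k <- s) F k).
Proof. by move=> h; elim/big_ind: _ => // [|p q]; [exact: rotsum0 | exact: rotsumD]. Qed.

(** In the formula of rotsum_harmM the factor 2 - k(k+1) equals
    -(k-1)(k+2). *)
Lemma rotsum_harm_rigid k w b : (forall i, harm k (w i)) ->
  rotsum ((k%:R - 1)%:MP * dotv w (rigid b)).
Proof.
move=> hw; have n0 : k%:R + 2 != 0 :> R by rewrite -natrD pnatr_eq0 addnS.
rewrite (_ : _ * _ = (- (k%:R + 2)^-1)%:MP *
   \sum_i (2 - k%:R * (k%:R + 1))%:MP * (w i * rigid b i)).
  by apply/rotsumCM/rotsum_sum => i; apply: rotsum_harmM => //; apply: harm_rigid.
rewrite -mulr_sumr mulrA -mpolyCM; congr (_%:MP * _); field; exact: n0.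
Qed.

(** Radial vectors are orthogonal to b /\ x, and a gradient paired with b /\ x
    is a combination of rotational derivatives; what remains of the traction
    is mu (k - 1) w. *)
Lemma rotsum_traction_hom k u b : (forall i, hom k%:R (u i)) -> elastic u ->
  rotsum (dotv (traction u) (rigid b)).
Proof.
move=> hu eu; have [w hw uw] := hom_elastic_field hu eu.
have -> : dotv (traction u) (rigid b) = mu%:MP * ((k%:R - 1)%:MP * dotv w (rigid b)) +
   ((mu * (k%:R - 1) * elastic_coef k)%:MP * dotv (gradv (sqnorm * divg w)) (rigid b) +
    mu%:MP * dotv (gradv (dotv X u)) (rigid b)).
  have DN2 i : D i (sqnorm * divg w) = X i * (divg w *+ 2) + sqnorm * D i (divg w).
    by rewrite DM D_sqnorm; ring.
  transitivity (dotv (lincomb (mu * (k%:R - 1))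
    (lincomb 1 w (elastic_coef k) (lincomb 1 (gradv (sqnorm * divg w)) (-1) (fun i => X i * (divg w *+ 2))))
    1 (lincomb lam (fun i => X i * divg u) mu (gradv (dotv X u)))) (rigid b)).
    apply: eq_dotvl => i; rewrite tractionE hu /lincomb /gradv DN2 (uw i) /elastic_field.
    by rewrite mpolyC1; ring.
  by rewrite !dotv_lin !dotX_rigid; ring.
apply: rotsumD; first exact/rotsumCM/rotsum_harm_rigid.
by apply: rotsumD; apply: rotsumCM; apply: rotsum_grad_rigid.
Qed.

Lemma rotsum_traction u b : elastic u ->
  rotsum (dotv (traction u) (rigid b)).
Proof.
elim/elastic_ind => [{}u v e|{}u v hu hv|k w hw].
- by rewrite (@eq_dotvl (traction u) (traction v)) // => i; apply: eq_traction.
- rewrite (_ : dotv _ _ = dotv (traction u) (rigid b) + dotv (traction v) (rigid b)); first exact: rotsumD.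
  transitivity (dotv (lincomb 1 (traction u) 1 (traction v)) (rigid b)).
    apply: eq_dotvl => i; rewrite /lincomb -traction_lin; apply: eq_traction => j.
    by rewrite /lincomb mpolyC1 !mul1r.
  by rewrite dotv_lin mpolyC1 !mul1r.
- apply: (@rotsum_traction_hom k); last exact: elastic_elastic_field.
  move=> i; apply: homD; first by case: (hw i).
  apply: homCM; rewrite (_ : k%:R = 2 + (k%:R - 1 - 1)); last by ring.
  apply: homM; first exact: hom_sqnorm.
  by apply/hom_D/euler_divg_hom => j; case: (hw j).
Qed.
End ElasticFields.

(** * Evaluation and translation of polynomials *)

Section Eval.
Context (R : realFieldType).
Local Notation P := {mpoly R[3]}.
Implicit Types (p q f g h : P) (i j : 'I_3) (u v w F G : 'I_3 -> P) (x y : 'rV[R]_3) (k : nat) (a : 'rV[R]_3) (c : R).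

Definition ev p x : R := p.@[fun i => x ord0 i].

Lemma evD p q x : ev (p + q) x = ev p x + ev q x. Proof. exact: mevalD. Qed.
Lemma evN p x : ev (- p) x = - ev p x. Proof. exact: mevalN. Qed.
Lemma evM p q x : ev (p * q) x = ev p x * ev q x. Proof. exact: mevalM. Qed.
Lemma evC c x : ev c%:MP x = c. Proof. exact: mevalC. Qed.
Lemma evX i x : ev (X R i) x = x ord0 i. Proof. exact: mevalXU. Qed.
Lemma ev0 x : ev 0 x = 0. Proof. exact: meval0. Qed.
Lemma ev1 x : ev 1 x = 1. Proof. exact: meval1. Qed.
Lemma ev_sum (I : Type) (s : seq I) (Q : pred I) (F : I -> P) x :
  ev (\sum_(k <- s | Q k) F k) x = \sum_(k <- s | Q k) ev (F k) x.
Proof. exact: raddf_sum. Qed.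

Definition shift x p : P := p \mPo [tuple 'X_i + (x ord0 i)%:MP | i < 3].

Lemma ev_shift a p x : ev (shift a p) x = ev p (x + a).
Proof.
rewrite /ev /shift comp_mpoly_meval; apply: meval_eq => i.
by rewrite tnth_mktuple mevalD mevalXU mevalC mxE.
Qed.

Lemma shiftD a p q : shift a (p + q) = shift a p + shift a q.
Proof. exact: comp_mpolyD. Qed.
Lemma shiftC a c : shift a c%:MP = c%:MP.
Proof. exact: comp_mpolyC. Qed.
Lemma shift0 a : shift a 0 = 0.
Proof. exact: comp_mpoly0. Qed.
Lemma shiftM a p q : shift a (p * q) = shift a p * shift a q.
Proof. exact: (rmorphM (comp_mpoly _)). Qed.

Lemma D_shift a i p : D i (shift a p) = shift a (D i p).
Proof.
elim/mpoly_algind: p => [c|p q hp hq|j p hp].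
- by rewrite (shiftC a c) !DC shift0.
- by rewrite (shiftD a p q) !Dadd hp hq (shiftD a (D i p)).
- rewrite (shiftM a (X R j) p) !DM hp (shiftD a (D i (X R j) * p)).
  rewrite (shiftM a _ p) (shiftM a (X R j)); congr (_ * _ + _).
  rewrite /shift comp_mpolyXU -tnth_nth tnth_mktuple Dadd DC addr0 DX.
  by rewrite -mpolyC_nat comp_mpolyC.
Qed.

Lemma mnm_neq0 (m : 'X_{1..3}) : m != 0%MM -> exists i, m i != 0%N.
Proof.
move=> m0; apply/existsP; apply: contraR m0; rewrite negb_exists => /forallP hm0.
by apply/eqP/mnmP => i; rewrite mnm0E; apply/eqP; have := hm0 i; rewrite negbK.
Qed.

Lemma mnm_subK (m : 'X_{1..3}) i : m i != 0%N -> m = (m - U_(i) + U_(i))%MM.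
Proof. by move=> mi; rewrite submK // lep1mP. Qed.

Lemma ev_at0 p : ev p 0 = p@_0.
Proof.
elim/mpolyind: p => [|c m p _ _ IH]; first by rewrite ev0 mcoeff0.
rewrite evD IH mcoeffD; congr (_ + _).
rewrite -mul_mpolyC evM evC mcoeffCM mcoeffX; congr (_ * _).
case: eqP => [->|/eqP/mnm_neq0 [i mi]]; first by rewrite mpolyX0 ev1.
by rewrite (mnm_subK mi) mpolyXD evM -/(X R i) evX mxE mulr0.
Qed.

(** Up to factorials, the coefficients of p are its derivatives at the origin. *)
Lemma ev_eq0 (Z : P -> Prop) p : (forall q, Z q -> forall i, Z (D i q)) ->
  (forall q, Z q -> ev q 0 = 0) -> Z p -> p = 0.
Proof.
move=> ZD Z0 Zp; apply/mpolyP => m; rewrite mcoeff0.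
have [n] := ubnP (mdeg m); elim: n => // n IH in m p Zp * => hm.
have [->|/mnm_neq0 [i mi]] := eqVneq m 0%MM; first by rewrite -ev_at0; apply: Z0.
have e := mnm_subK mi.
have := mcoeff_mderiv i p (m - U_(i))%MM; rewrite -e IH; last 2 first.
+ exact: ZD.
+ by move: hm; rewrite {1}e mdegD mdeg1 addn1 ltnS.
by move/esym/eqP; rewrite -mulr_natr mulf_eq0 pnatr_eq0 orbF => /eqP.
Qed.

(** When derivatives are limits, vanishing functions have vanishing derivatives,
    and ev_eq0 applies to the difference of p and q. *)
Lemma ev_inj_of :
  (forall p, (forall x, ev p x = 0) -> forall i x, ev (D i p) x = 0) ->
  forall p q, (forall x, ev p x = ev q x) -> p = q.
Proof.
move=> H p q e; apply/eqP; rewrite -subr_eq0; apply/eqP.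
apply: (@ev_eq0 (fun q => forall x, ev q x = 0)) => [f hf i x|f hf //|x].
  exact: H.
by rewrite evD evN e subrr.
Qed.

Lemma lap_shift a p : lap (shift a p) = shift a (lap p).
Proof.
by rewrite /lap !(sum3 _ 0) !D_shift (shiftD a (_ + _)) (shiftD a (D 0 _)).
Qed.
Lemma divg_shift a u : divg (fun i => shift a (u i)) = shift a (divg u).
Proof.
by rewrite /divg !(sum3 _ 0) !D_shift (shiftD a (_ + _)) (shiftD a (D 0 _)).
Qed.
Lemma elastic_shift lam mu a u : elastic lam mu u -> elastic lam mu (fun j => shift a (u j)).
Proof.
move=> eu i; rewrite /lame_op lap_shift divg_shift D_shift -[RHS](shift0 a) -(eu i).
by rewrite /lame_op (shiftD a (_ * _)) !(shiftM a _%:MP_[3]) !(shiftC a).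
Qed.

Lemma homog_polyE k (f : 'rV[R]_3 -> R) : homog_poly k f ->
  exists2 p, hom k%:R p & forall x, f x = ev p x.
Proof. by move=> [p hp e]; exists p => //; apply: dhomog_hom. Qed.
Lemma hom_homog_poly k p : hom k%:R p -> homog_poly k (ev p).
Proof. by move=> hp; exists p => //; apply: hom_dhomog. Qed.

Lemma lincomb1 u v i : lincomb 1 u 1 v i = u i + v i.
Proof. by rewrite /lincomb mpolyC1 !mul1r. Qed.

Definition zerov : 'I_3 -> P := fun=> 0.

Lemma lincomb0 u v i : lincomb 0 u 0 v i = zerov i.
Proof. by rewrite /lincomb mpolyC0 !mul0r addr0. Qed.
Lemma eq_elastic_field lam mu k u v : (forall i, u i = v i) ->
  forall i, elastic_field lam mu k u i = elastic_field lam mu k v i.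
Proof. by move=> e i; rewrite /elastic_field e (eq_divg e). Qed.
Lemma elastic_field0 lam mu k i : elastic_field lam mu k zerov i = zerov i.
Proof. by rewrite /elastic_field /divg big1 ?D0 ?mulr0 ?addr0 // => j _; rewrite D0. Qed.

Lemma shift_zerov a i : shift a (zerov i) = zerov i.
Proof. exact: shift0. Qed.

Definition combo n (d : 'I_n -> R) (q : 'I_n -> P) : P := \sum_s (d s)%:MP * q s.

Lemma ev_combo n (d : 'I_n -> R) (q : 'I_n -> P) x :
  ev (combo d q) x = \sum_s d s * ev (q s) x.
Proof. by rewrite /combo ev_sum; apply: eq_bigr => s _; rewrite evM evC. Qed.

Lemma combo_ind n (q : 'I_n -> P) (d : 'I_3 -> 'I_n -> R) (Q : ('I_3 -> P) -> Prop) :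
  (forall u v, (forall i, u i = v i) -> Q u -> Q v) ->
  (forall (a b : R) u v, Q u -> Q v -> Q (lincomb a u b v)) -> Q zerov ->
  (forall j s, Q (single j (q s))) -> Q (fun i => combo (d i) q).
Proof.
move=> Qe Ql Q0 Qs.
have H j : Q (single j (combo (d j) q)).
  rewrite /combo; elim: (index_enum _) => [|s l IH].
    by apply: (Qe _ _ _ Q0) => i; rewrite big_nil /single if_same.
  apply: (Qe _ _ _ (Ql (d j s) 1 _ _ (Qs j s) IH)) => i.
  by rewrite /lincomb /single big_cons; case: eqP => _; rewrite mpolyC1; ring.
have := Ql 1 1 _ _ (H 0) (Ql 1 1 _ _ (H (0 + 1)) (H (0 + 2))).
apply: Qe => i; rewrite /lincomb mpolyC1 /single.
by have [->|->|->] := ord3_cases i; rewrite ?(eqxx, ord3_eqF); ring.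
Qed.

Lemma elastic_field_lin lam mu k (a b : R) u v i :
  elastic_field lam mu k (lincomb a u b v) i =
  lincomb a (elastic_field lam mu k u) b (elastic_field lam mu k v) i.
Proof. by rewrite /elastic_field divg_lin /lincomb !(DE, DC, D0); ring. Qed.

Lemma ev_elastic_field_single lam mu k j p i x :
  ev (elastic_field lam mu k (single j p) i) x =
  (i == j)%:R * ev p x + elastic_coef lam mu k * (ev (sqnorm R) x * ev (D i (D j p)) x).
Proof.
rewrite /elastic_field divg_single evD !evM evC; congr (_ + _).
by rewrite /single; case: eqP; rewrite ?mul1r ?mul0r ?ev0.
Qed.

Lemma ev_rotsum p : rotsum p ->
  exists g : 'I_3 -> P, forall x, ev p x = \sum_i ev (rotd (g i) i) x.
Proof. by move=> [g ->]; exists g => x; rewrite ev_sum. Qed.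

(** One step of the random walk used for approximation. *)
Lemma ev_mix p q i (c : R) : exists f, forall x,
  ev f x = (1 + x ord0 i / c) / 2 * ev p x + (1 - x ord0 i / c) / 2 * ev q x.
Proof.
exists ((1 + X R i * (c^-1)%:MP) * (2^-1)%:MP * p + (1 - X R i * (c^-1)%:MP) * (2^-1)%:MP * q).
by move=> x; rewrite !(evD, evN, evM, evC, evX, ev1).
Qed.

Definition cstv (c : 'I_3 -> R) i : P := (c i)%:MP.

(** So |x /\ c|^2 has mean (2/3) r^2 |c|^2 over the sphere of radius r. *)
Lemma rotsum_cross (c : 'I_3 -> R) :
  rotsum (dotv (crossv (X R) (cstv c)) (crossv (X R) (cstv c))
          - ((1 - 3^-1) * \sum_i c i ^+ 2)%:MP * sqnorm R).
Proof.
pose T i j := (- (c i * c j))%:MP * (X R i * X R j - ((i == j)%:R / 3)%:MP * sqnorm R).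
have hT i j : rotsum (T i j) by apply/rotsumCM/rotsum_XX.
rewrite (_ : _ - _ = \sum_i \sum_j T i j).
  by do 2 (apply: rotsum_sum => ?).
rewrite !(sum3 _ 0) /T /dotv /crossv /cstv !(sum3 _ 0) !ord3E.
rewrite !eqxx ?ord3_eqF.
rewrite /sqnorm /dotv !(sum3 _ 0) /=; move: (3^-1) => th; ring.
Qed.

Lemma eqS_ev (r : R) p q x : eqS r p q -> ev (sqnorm R) x = r ^+ 2 -> ev p x = ev q x.
Proof. by move=> [s ->] hx; rewrite /sphere_poly !(evD, evN, evM, evC) hx subrr mul0r addr0. Qed.

Lemma tanS_ev (r : R) F G x : tanS r F G -> ev (sqnorm R) x = r ^+ 2 ->
  exists c : R, forall i, ev (F i) x = ev (G i) x + x ord0 i * c.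
Proof.
move=> [g [w hw]] hx; exists (ev g x) => i.
by rewrite hw /sphere_poly !(evD, evN, evM, evC, evX) hx subrr mul0r addr0.
Qed.

Lemma ev_scale (c : R) p : exists q, forall x, ev q x = c * ev p x.
Proof. by exists (c%:MP * p) => x; rewrite evM evC. Qed.

Lemma elastic_zerov lam mu : elastic lam mu zerov.
Proof. by case: (solves0 lam mu 1). Qed.

Lemma elastic_lin (lam mu a b : R) u v : elastic lam mu u -> elastic lam mu v ->
  elastic lam mu (lincomb a u b v).
Proof. by move=> hu hv i; rewrite lame_op_lin hu hv !mulr0 addr0. Qed.

Lemma normal_solution (lam mu r : R) f : 0 < mu -> 0 < 3 * lam + 2 * mu -> 0 < r ->
  exists u, solves lam mu r u f zerov.
Proof. by move=> h1 h2 h3; apply: solvable_normal. Qed.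

Lemma tangential_solution (lam mu r : R) F : 0 < mu -> 0 < 3 * lam + 2 * mu -> 0 < r ->
  exists (c : 'I_3 -> R) u, solves lam mu r u 0 (fun i => F i + crossv (X R) (cstv c) i).
Proof. by move=> h1 h2 h3; have [c [u hu]] := tsolvable_all h1 h2 h3 F; exists c, u. Qed.
End Eval.

End PolyElasticity.

From mathcomp Require Import all_classical all_reals all_analysis.
Import Order.TTheory GRing.Theory Num.Theory numFieldNormedType.Exports.
Import PolyElasticity.
Local Open Scope classical_set_scope.
Local Open Scope ring_scope.

(** * Polynomials as differentiable functions *)

Notation poly3 R := (mpoly.mpoly 3 R).

Section Bridge.
Context {R : realType}.
Local Notation vec := 'rV[R]_3.
Implicit Types (p q : poly3 R) (u w : 'I_3 -> poly3 R) (x y v : vec) (i j : 'I_3).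

(** The map g will be a translation of the space or a parametrisation of the
    sphere by one of its angles. *)
Lemma is_derive_ev (V : normedModType R) (g : V -> vec) (a d : V) (dg : 'I_3 -> R) :
  (forall i, is_derive a d (fun z => g z ord0 i) (dg i)) ->
  forall p, is_derive a d (fun z => ev p (g z)) (\sum_i dg i * ev (D i p) (g a)).
Proof.
move=> hg; elim/mpoly_algind => [c|p q hp hq|i p hp].
- rewrite (_ : (fun z => _) = cst c); last by apply/funext => z; rewrite evC.
  rewrite big1; first exact: is_derive_cst.
  by move=> i _; rewrite DC ev0 mulr0.
- rewrite (_ : (fun z => _) = (fun z => ev p (g z)) + (fun z => ev q (g z))).
    apply: is_derive_eq; rewrite -big_split; apply: eq_bigr => i _.
    by rewrite Dadd evD mulrDr.
  by apply/funext => z; rewrite evD.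
- rewrite (_ : (fun z => _) = (fun z => g z ord0 i) * (fun z => ev p (g z))).
    apply: is_derive_eq; rewrite scaler_sumr.
    rewrite [RHS](eq_bigr (fun j => g a ord0 i * (dg j * ev (D j p) (g a)) +
                     dg j * ev (D j (X R i)) (g a) * ev p (g a))).
      rewrite big_split -mulr_suml; congr (_ + _); rewrite [RHS]mulrC; congr (_ * _).
      rewrite (bigD1 i) //= big1 ?addr0 ?DX ?eqxx ?ev1 ?mulr1 // => j /negPf ji.
      by rewrite DX ji ev0 mulr0.
    by move=> j _; rewrite DM evD !evM evX; ring.
  by apply/funext => z; rewrite evM evX.
Qed.

Lemma is_derive_coord x v i : is_derive x v (fun y : vec => y ord0 i) (v ord0 i).
Proof.
have dx := @differentiable_coord R 1 3 x ord0 i.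
apply: DeriveDef; first exact: diff_derivable.
have /derive_mx e := @derivable_id R _ x v.
have := congr1 (fun M : vec => M ord0 i) e.
by rewrite mxE derive_id.
Qed.

Lemma is_derive_ev_sub p (x0 x v : vec) :
  is_derive x v (fun z => ev p (z - x0)) (\sum_i v ord0 i * ev (D i p) (x - x0)).
Proof.
apply: (is_derive_ev (g := fun z => z - x0) (dg := fun i => v ord0 i)) => i.
rewrite (_ : (fun z => _) = (fun z : vec => z ord0 i) - cst (x0 ord0 i)).
  have := is_derive_coord x v i => d; rewrite -[v ord0 i]subr0; apply: is_deriveB.
by apply/funext => z; rewrite !mxE.
Qed.

Lemma is_derive_evx p x v : is_derive x v (ev p) (\sum_i v ord0 i * ev (D i p) x).
Proof. exact: (is_derive_ev (fun i => is_derive_coord x v i) p). Qed.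

Lemma sum_evec i (F : 'I_3 -> R) : \sum_j evec i ord0 j * F j = F i.
Proof.
rewrite (bigD1 i) //= big1 ?addr0; first by rewrite mxE !eqxx mul1r.
by move=> j /negPf ji; rewrite mxE ji mul0r.
Qed.

Lemma pderiv_ev_sub i p x0 : pderiv i (fun z => ev p (z - x0)) = fun z => ev (D i p) (z - x0).
Proof.
apply/funext => x; rewrite /pderiv.
by have -> := @derive_val _ _ _ _ _ _ _ (is_derive_ev_sub p x0 x (evec i)); rewrite sum_evec.
Qed.

Lemma pderiv_ev i p : pderiv i (ev p) = ev (D i p).
Proof.
apply/funext => x; rewrite /pderiv.
by have -> := @derive_val _ _ _ _ _ _ _ (is_derive_evx p x (evec i)); rewrite sum_evec.
Qed.

Lemma laplacian_ev p x : laplacian (ev p) x = ev (lap p) x.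
Proof.
by rewrite /laplacian /lap ev_sum; apply: eq_bigr => i _; rewrite !pderiv_ev.
Qed.

(** Over the reals the formal derivatives are limits, as ev_inj_of requires. *)
Lemma ev_inj p q : (forall x, ev p x = ev q x) -> p = q.
Proof.
apply: ev_inj_of => f hf i x.
by rewrite -pderiv_ev (_ : ev f = cst 0) ?/pderiv ?derive_cst //; apply/funext.
Qed.

Definition evv u x : vec := \row_i ev (u i) x.

Lemma derive_evv_sub u x0 x v :
  'D_v (fun z => evv u (z - x0)) x = \row_i \sum_j v ord0 j * ev (D j (u i)) (x - x0).
Proof.
have e i : (fun z => evv u (z - x0) ord0 i) = fun z => ev (u i) (z - x0).
  by apply/funext => z; rewrite mxE.
rewrite derive_mx.
  apply/rowP => i; rewrite !mxE e.
  exact: (@derive_val _ _ _ _ _ _ _ (is_derive_ev_sub (u i) x0 x v)).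
apply/derivable_mxP => i j; rewrite ord1 e.
exact: (@ex_derive _ _ _ _ _ _ _ (is_derive_ev_sub (u j) x0 x v)).
Qed.

Lemma component_evv i u x0 : component i (fun z => evv u (z - x0)) = fun z => ev (u i) (z - x0).
Proof. by apply/funext => z; rewrite /component mxE. Qed.

Lemma divergence_evv u x0 x : divergence (fun z => evv u (z - x0)) x = ev (divg u) (x - x0).
Proof.
by rewrite /divergence /divg ev_sum; apply: eq_bigr => i _; rewrite component_evv pderiv_ev_sub.
Qed.

Lemma stress_evv lam mu (x0 : vec) (r : R) u x :
  stress lam mu (unit_normal x0 r) (fun z => evv u (z - x0)) x =
  r^-1 *: evv (traction lam mu u) (x - x0).
Proof.
rewrite /stress derive_evv_sub divergence_evv /unit_normal; apply/rowP => i.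
rewrite !mxE /curl ?mxE !component_evv !pderiv_ev_sub.
under eq_bigr do rewrite [_ ord0 _]mxE -evX -mulrA -evM.
rewrite -mulr_sumr -ev_sum -/(euler (u i)).
by rewrite /traction /crossv /curlv !(evD, evN, evM, evC, evX) !mxE; ring.
Qed.

Lemma dot_evv u w x : dot (evv u x) (evv w x) = ev (dotv u w) x.
Proof. by rewrite /dot /dotv ev_sum; apply: eq_bigr => i _; rewrite !mxE evM. Qed.

Lemma evv_X x : evv (X R) x = x.
Proof. by apply/rowP => i; rewrite mxE evX. Qed.
End Bridge.

(** * Boundary pairs and their linear span *)

Section LinearSpan.
Context {R : realType} (V : lmodType R) (g : nat -> V).

Lemma span_mem k : linear_span g (g k).
Proof.
exists k.+1, (fun l => (l == k)%:R); rewrite (bigD1 ord_max) //= eqxx scale1r.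
rewrite big1 ?addr0 // => l; rewrite -val_eqE /= => /negPf->.
by rewrite scale0r.
Qed.

Lemma spanZ a z : linear_span g z -> linear_span g (a *: z).
Proof.
move=> [n [c ->]]; exists n, (fun l => a * c l).
by rewrite scaler_sumr; apply: eq_bigr => l _; rewrite scalerA.
Qed.

Lemma span_widen n (c : nat -> R) m : (n <= m)%N ->
  \sum_(k < n) c k *: g k = \sum_(k < m) (if (k < n)%N then c k else 0) *: g k.
Proof.
move=> nm; rewrite (big_ord_widen _ (fun k => c k *: g k) nm) big_mkcond.
by apply: eq_bigr => l _; case: ifP => // _; rewrite scale0r.
Qed.

Lemma spanD y z : linear_span g y -> linear_span g z -> linear_span g (y + z).
Proof.
move=> [n [c ->]] [m [d ->]].
rewrite (span_widen c (leq_maxl n m)) (span_widen d (leq_maxr n m)) -big_split.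
exists (maxn n m), (fun k => (if (k < n)%N then c k else 0) + (if (k < m)%N then d k else 0)).
by apply: eq_bigr => l _; rewrite scalerDl.
Qed.

Lemma span0 : linear_span g 0.
Proof. by exists 0%N, (fun=> 0); rewrite big_ord0. Qed.
End LinearSpan.

Section Boundary.
Context {R : realType} (lam mu : R) (x0 : 'rV[R]_3) (r : R).
Local Notation vec := 'rV[R]_3.
Implicit Types (p q : poly3 R) (u v w : 'I_3 -> poly3 R) (x y : vec) (i j : 'I_3).

Definition tangential t x : vec := t - dot t (unit_normal x0 r x) *: unit_normal x0 r x.

(** The boundary pair of the field u(x - x0), in polynomial terms. *)
Definition bdata u : (vec -> R) * (vec -> vec) :=
  (fun x => r^-1 * ev (dotv (X R) u) (x - x0),
   fun x => tangential (r^-1 *: evv (traction lam mu u) (x - x0)) x).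

Lemma boundary_pair_evv u : boundary_pair lam mu x0 r (fun x => evv u (x - x0)) = bdata u.
Proof.
rewrite /boundary_pair /bdata; congr pair; apply/funext => x; last by rewrite stress_evv.
rewrite /unit_normal /dot /dotv ev_sum mulr_sumr; apply: eq_bigr => i _.
by rewrite !mxE !evM !evX !mxE; ring.
Qed.

Lemma dotDl (s t n : vec) a b : dot (a *: s + b *: t) n = a * dot s n + b * dot t n.
Proof.
by rewrite /dot !mulr_sumr -big_split; apply: eq_bigr => i _; rewrite !mxE /=; ring.
Qed.

Lemma tangential_lin a b s t x :
  tangential (a *: s + b *: t) x = a *: tangential s x + b *: tangential t x.
Proof.
by rewrite /tangential dotDl; apply/rowP => i; rewrite !mxE; ring.
Qed.

Lemma bdata_lin1 a u b v x :
  (bdata (lincomb a u b v)).1 x = a * (bdata u).1 x + b * (bdata v).1 x.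
Proof. by rewrite /= dotX_lin evD !evM !evC mulrDr ![r^-1 * (_ * _)]mulrCA. Qed.

Lemma bdata_lin2 a u b v x :
  (bdata (lincomb a u b v)).2 x = a *: (bdata u).2 x + b *: (bdata v).2 x.
Proof.
rewrite /= -tangential_lin; congr tangential; apply/rowP => i.
by rewrite !mxE traction_lin evD !evM !evC; ring.
Qed.

Lemma bdata_lin a u b v : bdata (lincomb a u b v) = a *: bdata u + b *: bdata v.
Proof.
rewrite [LHS]surjective_pairing; congr pair; apply/funext => x; [exact: bdata_lin1|exact: bdata_lin2].
Qed.

Lemma bdata_add u v : (forall x, (bdata (lincomb 1 u 1 v)).1 x = (bdata u).1 x + (bdata v).1 x) /\
  (forall x, (bdata (lincomb 1 u 1 v)).2 x = (bdata u).2 x + (bdata v).2 x).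
Proof.
split=> x; first exact: etrans (bdata_lin1 1 u 1 v x) (f_equal2 +%R (mul1r _) (mul1r _)).
exact: etrans (bdata_lin2 1 u 1 v x) (f_equal2 +%R (scale1r _) (scale1r _)).
Qed.

Lemma eq_bdata u v : (forall i, u i = v i) -> bdata u = bdata v.
Proof.
move=> e; rewrite -!boundary_pair_evv; congr boundary_pair; apply/funext => x; apply/rowP => i.
by rewrite !mxE e.
Qed.
End Boundary.

Section ElasticSpan.
Context {R : realType} (lam mu : R) (x0 : 'rV[R]_3) (r : R).
Local Notation vec := 'rV[R]_3.
Implicit Types (p q : poly3 R) (u v w : 'I_3 -> poly3 R) (x y : vec) (i j : 'I_3).
Context (hmu : 0 < mu) (hlam : 0 < 3 * lam + 2 * mu) (hr : 0 < r).
Context (omega : forall k : nat, 'I_(2 * k).+1 -> (vec -> R))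
  (homega : forall k : nat, is_basis (harmonic_homog k) (omega k))
  (idx : nat -> elastic_index) (hidx : bijective idx).
Let p := fun k => elastic_system lam mu omega (idx k).
Let bp := fun k => boundary_pair lam mu x0 r (p k).
Local Notation bdata := (bdata lam mu x0 r).

Lemma harmonic_homogP k (f : vec -> R) :
  harmonic_homog k f -> exists2 q, harm k q & f = ev q.
Proof.
move=> [/homog_polyE [q hq fq] lf].
have e : f = ev q by apply/funext.
exists q => //; split=> //; apply: ev_inj => x.
by rewrite -laplacian_ev -e lf ev0.
Qed.

Lemma harm_homogP k q : harm k q -> harmonic_homog k (ev q).
Proof.
move=> [lq hq]; split; first exact: hom_homog_poly.
by move=> x; rewrite laplacian_ev lq ev0.
Qed.

Lemma elastic_polyE k q j :
  elastic_poly lam mu k (ev q) j = evv (elastic_field lam mu k (single j q)).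
Proof.
apply/funext => x; apply/rowP => i; rewrite [RHS]mxE ev_elastic_field_single /elastic_poly !mxE eqxx /=.
rewrite pderiv_ev pderiv_ev /enorm sqr_sqrtr.
  by rewrite -[x in dot x _]evv_X -[x in dot _ x]evv_X dot_evv -/(sqnorm R) eq_sym /Lambda /elastic_coef; ring.
by apply: sumr_ge0 => l _; rewrite -expr2 sqr_ge0.
Qed.

Lemma boundary_pair_in_span k s j : linear_span bp (boundary_pair lam mu x0 r (elastic_poly lam mu k (@omega k s) j)).
Proof.
have [idx' _ idxK] := hidx.
have := span_mem bp (idx' (existT _ k (s, j))).
by rewrite /bp /p idxK.
Qed.

Lemma bdata_shift v : boundary_pair lam mu x0 r (evv v) = bdata (fun i => shift x0 (v i)).
Proof.
rewrite -boundary_pair_evv; congr boundary_pair; apply/funext => x; apply/rowP => i.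
by rewrite !mxE ev_shift subrK.
Qed.

(** The field becomes a polynomial in x after the translation by -x0; it is then
    a sum of fields elastic_field k w, and the components of w are
    combinations of the basis omega k. *)
Lemma span_elastic u : elastic lam mu u -> linear_span bp (bdata u).
Proof.
move=> eu; pose B v := linear_span bp (boundary_pair lam mu x0 r (evv v)).
have Blin (a b : R) v w : B v -> B w -> B (lincomb a v b w).
  rewrite /B !bdata_shift => hv hw.
  rewrite (eq_bdata _ _ _ _ (v := lincomb a (fun i => shift x0 (v i)) b (fun i => shift x0 (w i)))).
    by rewrite bdata_lin; apply: spanD; apply: spanZ.
  by move=> i; rewrite /lincomb shiftD !shiftM !shiftC.
have Beq v w : (forall i, v i = w i) -> B v -> B w.
  by move=> e; rewrite /B !bdata_shift (eq_bdata _ _ _ _ (u := fun i => shift x0 (v i)) (v := fun i => shift x0 (w i))) // => i; rewrite e.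
suff : B (fun i => shift (- x0) (u i)).
  rewrite /B bdata_shift (eq_bdata _ _ _ _ (v := u)) // => i.
  by apply: ev_inj => x; rewrite !ev_shift addrK.
have := elastic_shift (- x0) eu.
apply: (elastic_ind hmu hlam Beq).
- move=> v w hv hw; apply: (Beq _ _ _ (Blin 1 1 _ _ hv hw)) => i.
  by rewrite lincomb1.
- move=> k w hw.
  have /choice [q hq] : forall s, exists q, harm k q /\ @omega k s = ev q.
    move=> s; case: (homega k) => [/(_ s) h _ _].
    by have [q hq e] := harmonic_homogP h; exists q.
  have /choice [d hd] : forall i, exists d, w i = combo d q.
    move=> i; case: (homega k) => [_ /(_ _ (harm_homogP (hw i))) [d e] _].
    exists d; apply: ev_inj => x; rewrite e ev_combo fct_sumE.
    by apply: eq_bigr => s _; rewrite -(hq s).2.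
  have Q0 : B (zerov R).
    rewrite /B bdata_shift (eq_bdata _ _ _ _ (v := lincomb 0 w 0 w)).
      by rewrite bdata_lin !scale0r addr0; apply: span0.
    by move=> i; rewrite lincomb0 shift_zerov.
  have Qw : B (elastic_field lam mu k (fun i => combo (d i) q)).
    apply: (@combo_ind R _ q d (fun w => B (elastic_field lam mu k w))).
    + move=> v v' e; apply: Beq => i; exact: eq_elastic_field.
    + move=> a b v v' hv hv'; apply: (Beq _ _ _ (Blin a b _ _ hv hv')) => i.
      by rewrite elastic_field_lin.
    + by apply: Beq Q0 => i; rewrite elastic_field0.
    + by move=> j s; rewrite /B -elastic_polyE -(hq s).2; apply: boundary_pair_in_span.
  by apply: Beq Qw => i; apply: eq_elastic_field => j; rewrite hd.
Qed.
End ElasticSpan.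

(** * Iterated integrals *)

Section DoubleIntegral.
Context {R : realType}.
Implicit Types (h k : R -> R -> R) (t s : R).
Local Notation mu := (@lebesgue_measure R).

Lemma Rint_FTC (F f : R -> R) (a b : R) : a < b ->
  (forall x : R, is_derive x 1 F (f x)) -> continuous f ->
  \int[mu]_(x in `[a, b]) f x = F b - F a.
Proof.
move=> ab dF cf; have cF : continuous F.
  move=> x; apply: differentiable_continuous; apply/derivable1_diffP.
  exact: (@ex_derive _ _ _ _ _ _ _ (dF x)).
rewrite /Rintegral (continuous_FTC2 ab (F := F)) //.
- exact: continuous_subspaceT.
- split => [x _||].
  + exact: (@ex_derive _ _ _ _ _ _ _ (dF x)).
  + exact/cvg_at_right_filter/cF.
  + exact/cvg_at_left_filter/cF.
- by move=> x _; rewrite derive1E (@derive_val _ _ _ _ _ _ _ (dF x)).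
Qed.

Definition iterint h : R :=
  \int[mu]_(t in `[0, pi]) \int[mu]_(s in `[0, 2 * pi]) h t s.

(** Enough for the inner integral to be continuous in the outer variable, by
    dominated convergence, and hence for the iterated integral to be linear. *)
Definition sep_cont h := [/\ forall t, continuous (h t), forall s, continuous (h^~ s)
  & exists M, forall t s, `|h t s| <= M].

Lemma sep_contD h k : sep_cont h -> sep_cont k -> sep_cont (fun t s => h t s + k t s).
Proof.
move=> [h1 h2 [M hM]] [k1 k2 [N kN]]; split.
- by move=> t x; apply: cvgD; [exact: h1|exact: k1].
- by move=> s x; apply: cvgD; [exact: h2|exact: k2].
- by exists (M + N) => t s; rewrite (le_trans (ler_normD _ _)) ?lerD.
Qed.

Lemma sep_contM h k : sep_cont h -> sep_cont k -> sep_cont (fun t s => h t s * k t s).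
Proof.
move=> [h1 h2 [M hM]] [k1 k2 [N kN]]; split.
- by move=> t x; apply: cvgM; [exact: h1|exact: k1].
- by move=> s x; apply: cvgM; [exact: h2|exact: k2].
- by exists (M * N) => t s; rewrite normrM ler_pM.
Qed.

Lemma sep_cont_cst c : sep_cont (fun _ _ => c).
Proof. by split=> [t x|s x|]; [exact: cvg_cst|exact: cvg_cst|exists `|c|]. Qed.

Lemma sep_cont_l (f : R -> R) M : continuous f -> (forall t, `|f t| <= M) -> sep_cont (fun t _ => f t).
Proof. by move=> cf fM; split=> [t x|s|]; [exact: cvg_cst|exact: cf|exists M]. Qed.
Lemma sep_cont_r (f : R -> R) M : continuous f -> (forall t, `|f t| <= M) -> sep_cont (fun _ s => f s).
Proof. by move=> cf fM; split=> [t|s x|]; [exact: cf|exact: cvg_cst|exists M]. Qed.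

Lemma Rint_cont_integrable (f : R -> R) (a b : R) : continuous f ->
  mu.-integrable `[a, b] (EFin \o f).
Proof.
move=> cf; apply: continuous_compact_integrable; first exact: segment_compact.
exact: continuous_subspaceT.
Qed.

Definition inner h t := \int[mu]_(s in `[0, 2 * pi]) h t s.

Lemma inner_continuous h : sep_cont h -> continuous (inner h).
Proof.
move=> [h1 h2 [M hM]] t.
have tI : t \in `]t - 1, t + 1[%classic.
  by rewrite inE /= in_itv /= ltrBlDr ltrDl ltr01.
apply: (@continuity_under_integral R _ _ mu h `[0, 2 * pi] _ (t - 1) (t + 1) _ _ (cst M)) => //.
- by move=> x _; apply: Rint_cont_integrable.
- by apply: aeW => s _ x _; apply: h2.
- by apply: Rint_cont_integrable; apply: cst_continuous.
- by move=> x _; apply: aeW => s.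
Qed.

Lemma iterintE h : iterint h = \int[mu]_(t in `[0, pi]) inner h t.
Proof. by []. Qed.

Lemma iterintD h k : sep_cont h -> sep_cont k -> iterint (fun t s => h t s + k t s) = iterint h + iterint k.
Proof.
move=> hh hk; rewrite !iterintE -RintegralD //; last 2 first.
- exact/Rint_cont_integrable/inner_continuous.
- exact/Rint_cont_integrable/inner_continuous.
congr Rintegral; apply/funext => t; rewrite /inner RintegralD //.
- by apply: Rint_cont_integrable; case: hh.
- by apply: Rint_cont_integrable; case: hk.
Qed.

Lemma iterintZ c h : sep_cont h -> iterint (fun t s => c * h t s) = c * iterint h.
Proof.
move=> hh; rewrite !iterintE -RintegralZl //; last first.
  exact/Rint_cont_integrable/inner_continuous.
congr Rintegral; apply/funext => t; rewrite /inner RintegralZl //.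
by apply: Rint_cont_integrable; case: hh.
Qed.

Lemma le_iterint h k : sep_cont h -> sep_cont k ->
  (forall t s, 0 <= t <= pi -> h t s <= k t s) -> iterint h <= iterint k.
Proof.
move=> hh hk hle; rewrite !iterintE; apply: le_Rintegral => //.
- exact/Rint_cont_integrable/inner_continuous.
- exact/Rint_cont_integrable/inner_continuous.
move=> t /=; rewrite in_itv /= => ht; apply: le_Rintegral => //.
- by apply: Rint_cont_integrable; case: hh.
- by apply: Rint_cont_integrable; case: hk.
by move=> s _; apply: hle.
Qed.

Lemma pi2_gt0 : 0 < 2 * pi :> R.
Proof. by rewrite mulr_gt0 ?pi_gt0. Qed.

Lemma iterint_dr (h h' : R -> R -> R) :
  (forall t s, is_derive s 1 (h t) (h' t s)) -> (forall t, continuous (h' t)) ->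
  (forall t, h t (2 * pi) = h t 0) -> iterint h' = 0.
Proof.
move=> dh ch per; rewrite /iterint.
under eq_Rintegral do rewrite (Rint_FTC pi2_gt0 (dh _) (ch _)) per subrr.
by rewrite Rintegral_cst // mul0r.
Qed.

(** The derivative in the outer variable is exchanged with the inner integral. *)
Lemma iterint_dl (h h' : R -> R -> R) : sep_cont h -> sep_cont h' ->
  (forall t s, is_derive t 1 (h^~ s) (h' t s)) ->
  (forall s, h pi s = h 0 s) -> iterint h' = 0.
Proof.
move=> Ch Ch' dh per; rewrite iterintE.
have [h1 h2 [M hM]] := Ch'.
have dI : forall t, is_derive t 1 (inner h) (inner h' t); last first.
  rewrite (Rint_FTC (pi_gt0 R) dI (inner_continuous Ch')) /inner.
  by under eq_Rintegral do rewrite per; rewrite subrr.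
move=> t.
have tI : `]t - 1, t + 1[%classic t.
  by rewrite /= in_itv /= ltrBlDr ltrDl ltr01.
have d1E x s : partial1of2 h x s = h' x s.
  by rewrite partial1of2E (@derive_val _ _ _ _ _ _ _ (dh x s)).
have H1 : forall x : R, `]t - 1, t + 1[%classic x -> mu.-integrable `[0, 2 * pi] (EFin \o h x).
  by move=> x _; apply: Rint_cont_integrable; case: Ch.
have H2 : forall x s : R, `]t - 1, t + 1[%classic x -> `[0, 2 * pi]%classic s -> derivable (h^~ s) x 1.
  by move=> x s _ _; apply: (@ex_derive _ _ _ _ _ _ _ (dh x s)).
have M0 : forall s : R, 0 <= cst M s by move=> s; apply: le_trans (hM 0 0); rewrite ?normr_ge0.
have H3 : mu.-integrable `[0, 2 * pi] (EFin \o cst M).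
  by apply: Rint_cont_integrable; apply: cst_continuous.
have H4 : forall x s : R, `]t - 1, t + 1[%classic x -> `[0, 2 * pi]%classic s ->
    `|partial1of2 h x s| <= cst M s.
  by move=> x s _ _; rewrite d1E.
apply: DeriveDef.
  exact: (derivable_under_integral _ tI H1 H2 M0 H3 H4).
rewrite -derive1E (differentiation_under_integral _ tI H1 H2 M0 H3 H4) //.
by rewrite /inner; apply: eq_Rintegral => s _; rewrite d1E.
Qed.
End DoubleIntegral.

(** * Spherical coordinates *)

Section Sphere.
Context {R : realType} (x0 : 'rV[R]_3) (r : R) (hr : 0 < r).
Local Notation vec := 'rV[R]_3.
Implicit Types (p q : poly3 R) (u v w : 'I_3 -> poly3 R) (x y : vec) (i j : 'I_3) (t s : R).

Definition sphere_pt t s : vec :=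
  r *: \row_(i < 3) [:: sin t * cos s; sin t * sin s; cos t]`_i.
Definition sphere_pt_dt t s : vec :=
  r *: \row_(i < 3) [:: cos t * cos s; cos t * sin s; - sin t]`_i.
Definition sphere_pt_ds t s : vec :=
  r *: \row_(i < 3) [:: - (sin t * sin s); sin t * cos s; 0]`_i.

Lemma row3E (a b c : R) : let v := r *: \row_(i < 3) [:: a; b; c]`_i : vec in
  [/\ v ord0 0 = r * a, v ord0 (0 + 1) = r * b & v ord0 (0 + 2) = r * c].
Proof. by split; rewrite !mxE. Qed.

Lemma dot_yp t s : dot (sphere_pt t s) (sphere_pt t s) = r ^+ 2.
Proof.
rewrite /dot (sum3 _ 0); have [-> -> ->] := row3E (sin t * cos s) (sin t * sin s) (cos t).
have e1 : cos t ^+ 2 = 1 - sin t ^+ 2 by rewrite -(cos2Dsin2 t); ring.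
have e2 : cos s ^+ 2 = 1 - sin s ^+ 2 by rewrite -(cos2Dsin2 s); ring.
by ring: e1 e2.
Qed.

Lemma is_derive_row3 (f g h : R -> R) (df dg dh a : R) :
  is_derive a 1 f df -> is_derive a 1 g dg -> is_derive a 1 h dh ->
  forall i, is_derive a 1 (fun z => (r *: \row_(i < 3) [:: f z; g z; h z]`_i : vec) ord0 i)
    ((r *: \row_(i < 3) [:: df; dg; dh]`_i : vec) ord0 i).
Proof.
move=> hf hg hh i; rewrite !mxE.
have -> : (fun z => (r *: \row_(i < 3) [:: f z; g z; h z]`_i : vec) ord0 i) =
  r \*: [:: f; g; h]`_i.
  by apply/funext => z; rewrite !mxE; case: i => -[|[|[|//]]].
by apply: is_deriveZ; case: i => -[|[|[|//]]].
Qed.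

Lemma yp_dt t s i : is_derive t 1 (fun t => sphere_pt t s ord0 i) (sphere_pt_dt t s ord0 i).
Proof.
apply: is_derive_row3.
- by apply: is_derive_eq; rewrite scaler0 add0r mulrC.
- by apply: is_derive_eq; rewrite scaler0 add0r mulrC.
Qed.

Lemma yp_ds t s i : is_derive s 1 (fun s => sphere_pt t s ord0 i) (sphere_pt_ds t s ord0 i).
Proof.
apply: is_derive_row3.
by apply: is_derive_eq; rewrite scalerN.
Qed.

Lemma yp_abs t s i : `|sphere_pt t s ord0 i| <= r.
Proof.
rewrite mxE normrM gtr0_norm // mxE -[leRHS]mulr1 ler_pM2l //.
case: i => -[|[|[|//]]] Hi /=; rewrite ?normrM ?mulr_ile1 ?normr_ge0 ?cos_max ?sin_max //.
Qed.

Lemma continuous_derive (f f' : R -> R) : (forall t, is_derive t 1 f (f' t)) -> continuous f.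
Proof.
move=> df t; apply: differentiable_continuous; apply/derivable1_diffP.
exact: (@ex_derive _ _ _ _ _ _ _ (df t)).
Qed.

Lemma sep_cont_ev p : sep_cont (fun t s => ev p (sphere_pt t s)).
Proof.
elim/mpoly_algind: p => [c|p q hp hq|i p hp].
- rewrite (_ : (fun _ => _) = fun _ _ => c); first exact: sep_cont_cst.
  by apply/funext => t; apply/funext => s; rewrite evC.
- rewrite (_ : (fun _ => _) = fun t s => ev p (sphere_pt t s) + ev q (sphere_pt t s)); first exact: sep_contD.
  by apply/funext => t; apply/funext => s; rewrite evD.
- rewrite (_ : (fun _ => _) = fun t s => sphere_pt t s ord0 i * ev p (sphere_pt t s)).
    apply: sep_contM hp; split=> [t|s|]; last by exists r => t s; apply: yp_abs.
    + exact: (continuous_derive (yp_ds t ^~ i)).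
    + exact: (continuous_derive (fun t => yp_dt t s i)).
  by apply/funext => t; apply/funext => s; rewrite evM evX.
Qed.

Lemma sep_cont_sinl : sep_cont (fun t _ => sin t : R).
Proof. by apply: (@sep_cont_l _ _ 1); [exact: continuous_sin | exact: sin_max]. Qed.
Lemma sep_cont_cosl : sep_cont (fun t _ => cos t : R).
Proof. by apply: (@sep_cont_l _ _ 1); [exact: continuous_cos | exact: cos_max]. Qed.
Lemma sep_cont_sinr : sep_cont (fun _ s => sin s : R).
Proof. by apply: (@sep_cont_r _ _ 1); [exact: continuous_sin | exact: sin_max]. Qed.
Lemma sep_cont_cosr : sep_cont (fun _ s => cos s : R).
Proof. by apply: (@sep_cont_r _ _ 1); [exact: continuous_cos | exact: cos_max]. Qed.

Definition polar_int (f : vec -> R) : R := iterint (fun t s => f (sphere_pt t s) * (r ^+ 2 * sin t)).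

Lemma sep_cont_weight h : sep_cont h -> sep_cont (fun t s => h t s * (r ^+ 2 * sin t)).
Proof. by move=> hh; apply: sep_contM => //; apply: sep_contM (sep_cont_cst _) sep_cont_sinl. Qed.

Lemma d_ev_t p t s :
  is_derive t 1 (fun t => ev p (sphere_pt t s)) (\sum_i sphere_pt_dt t s ord0 i * ev (D i p) (sphere_pt t s)).
Proof. exact: (is_derive_ev (fun i => yp_dt t s i) p). Qed.
Lemma d_ev_s p t s :
  is_derive s 1 (fun s => ev p (sphere_pt t s)) (\sum_i sphere_pt_ds t s ord0 i * ev (D i p) (sphere_pt t s)).
Proof. exact: (is_derive_ev (fun i => yp_ds t s i) p). Qed.

Lemma sep_cont_sum (F : 'I_3 -> R -> R -> R) : (forall i, sep_cont (F i)) ->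
  sep_cont (fun t s => \sum_i F i t s).
Proof.
move=> hF; under eq_fun do under eq_fun do rewrite (sum3 _ 0).
by do 2?apply: sep_contD.
Qed.

Lemma sep_cont_pt_dt i : sep_cont (fun t s => sphere_pt_dt t s ord0 i).
Proof.
under eq_fun do under eq_fun do rewrite !mxE; apply: sep_contM; first exact: sep_cont_cst.
case: i => -[|[|[|//]]] Hi /=; try apply: sep_contM.
all: try exact: sep_cont_cosl. all: try exact: sep_cont_cosr; try exact: sep_cont_sinr.
under eq_fun do under eq_fun do rewrite -mulN1r.
exact: sep_contM (sep_cont_cst _) sep_cont_sinl.
Qed.
Lemma sep_cont_pt_ds i : sep_cont (fun t s => sphere_pt_ds t s ord0 i).
Proof.
under eq_fun do under eq_fun do rewrite !mxE; apply: sep_contM; first exact: sep_cont_cst.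
case: i => -[|[|[|//]]] Hi /=; last exact: sep_cont_cst.
  under eq_fun do under eq_fun do rewrite -mulN1r.
  apply: sep_contM (sep_cont_cst _) _; exact: sep_contM sep_cont_sinl sep_cont_sinr.
exact: sep_contM sep_cont_sinl sep_cont_cosr.
Qed.

Lemma yp_2pi t : sphere_pt t (2 * pi) = sphere_pt t 0.
Proof. by rewrite /sphere_pt mulr_natl cos2pi sin2pi cos0 sin0. Qed.

Lemma sep_cont_ev_dt p : sep_cont (fun t s => \sum_i sphere_pt_dt t s ord0 i * ev (D i p) (sphere_pt t s)).
Proof. by apply: sep_cont_sum => i; apply: sep_contM; [exact: sep_cont_pt_dt|exact: sep_cont_ev]. Qed.
Lemma sep_cont_ev_ds p : sep_cont (fun t s => \sum_i sphere_pt_ds t s ord0 i * ev (D i p) (sphere_pt t s)).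
Proof. by apply: sep_cont_sum => i; apply: sep_contM; [exact: sep_cont_pt_ds|exact: sep_cont_ev]. Qed.

Lemma eq_iterint h k : (forall t s, h t s = k t s) -> iterint h = iterint k.
Proof. by move=> e; congr iterint; apply/funext => t; apply/funext => s. Qed.

(** The rotation about the third axis is the derivative in the longitude s. *)
Lemma polar_int_rot_z p : polar_int (ev (rotd p (0 + 2))) = 0.
Proof.
rewrite /polar_int; pose w t : R := r ^+ 2 * sin t.
have hC := sep_cont_weight (sep_cont_ev_ds p).
rewrite (@eq_iterint _ (fun t s => (\sum_i sphere_pt_ds t s ord0 i * ev (D i p) (sphere_pt t s)) * w t)).
  apply: (@iterint_dr _ (fun t s => ev p (sphere_pt t s) * w t)) => [t s|t|t].
  - have := d_ev_s p t s => d; apply: is_derive_eq.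
    by rewrite scaler0 add0r mulrC.
  - by case: hC.
  - by rewrite yp_2pi.
move=> t s; congr (_ * _); rewrite /rotd /crossv /gradv !ord3E evD evN !evM !evX.
rewrite (sum3 _ 0); have [-> -> ->] := row3E (- (sin t * sin s)) (sin t * cos s) 0.
by have [-> -> _] := row3E (sin t * cos s) (sin t * sin s) (cos t); ring.
Qed.

(** In the angles t and s the rotation about the first axis satisfies
    sin t (y d_z - z d_y) P = - d_t (sin s sin t P) - d_s (cos t cos s P);
    the first bracket vanishes at the poles, the second one is periodic. *)
Lemma polar_int_rot_x p : polar_int (ev (rotd p 0)) = 0.
Proof.
pose P t s : R := ev p (sphere_pt t s).
pose Pt t s : R := \sum_i sphere_pt_dt t s ord0 i * ev (D i p) (sphere_pt t s).
pose Ps t s : R := \sum_i sphere_pt_ds t s ord0 i * ev (D i p) (sphere_pt t s).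
have dPt t s : is_derive t 1 (P^~ s) (Pt t s) := d_ev_t p t s.
have dPs t s : is_derive s 1 (P t) (Ps t s) := d_ev_s p t s.
have CP : sep_cont P := sep_cont_ev p.
have CPt : sep_cont Pt := sep_cont_ev_dt p.
have CPs : sep_cont Ps := sep_cont_ev_ds p.
pose A t s : R := sin s * (sin t * P t s).
pose A' t s : R := sin s * (cos t * P t s + sin t * Pt t s).
pose B t s : R := cos t * (cos s * P t s).
pose B' t s : R := cos t * (cos s * Ps t s + (-1) * (sin s * P t s)).
have CA : sep_cont A by apply: sep_contM sep_cont_sinr (sep_contM sep_cont_sinl CP).
have CA' : sep_cont A'.
  by apply: sep_contM sep_cont_sinr (sep_contD (sep_contM sep_cont_cosl CP) (sep_contM sep_cont_sinl CPt)).
have CB' : sep_cont B'.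
  apply: sep_contM sep_cont_cosl (sep_contD (sep_contM sep_cont_cosr CPs) (sep_contM (sep_cont_cst _) (sep_contM sep_cont_sinr CP))).
have IA : iterint A' = 0.
  apply: (iterint_dl CA CA') => [t s|s]; last by rewrite /A sinpi sin0 !mul0r.
  have d := dPt t s; apply: is_derive_eq; rewrite /A'.
  by rewrite /GRing.scale /=; ring.
have IB : iterint B' = 0.
  apply: (@iterint_dr _ B) => [t s|t|t].
  - have d := dPs t s; apply: is_derive_eq; rewrite /B' /GRing.scale /=; ring.
  - by case: CB'.
  - by rewrite /B /P yp_2pi mulr_natl cos2pi cos0.
rewrite /polar_int (@eq_iterint _ (fun t s => (- r ^+ 2) * (A' t s + B' t s))).
  by rewrite (iterintZ _ (sep_contD CA' CB')) (iterintD CA' CB') IA IB addr0 mulr0.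
move=> t s; rewrite /rotd /crossv /gradv evD evN !evM !evX /A' /B' /Pt /Ps !(sum3 _ 0).
have [-> -> ->] := row3E (- (sin t * sin s)) (sin t * cos s) 0.
have [-> -> ->] := row3E (cos t * cos s) (cos t * sin s) (- sin t).
have [_ -> ->] := row3E (sin t * cos s) (sin t * sin s) (cos t).
have e2 : cos s ^+ 2 = 1 - sin s ^+ 2 by rewrite -(cos2Dsin2 s); ring.
by ring: e2.
Qed.

Lemma polar_intD f g : sep_cont (fun t s => f (sphere_pt t s)) -> sep_cont (fun t s => g (sphere_pt t s)) ->
  polar_int (fun y => f y + g y) = polar_int f + polar_int g.
Proof.
move=> hf hg; rewrite /polar_int -iterintD; try exact: sep_cont_weight.
by apply: eq_iterint => t s; rewrite [LHS]mulrDl.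
Qed.
Lemma polar_intZ c f : sep_cont (fun t s => f (sphere_pt t s)) -> polar_int (fun y => c * f y) = c * polar_int f.
Proof.
move=> hf; rewrite /polar_int -iterintZ; try exact: sep_cont_weight.
by apply: eq_iterint => t s; rewrite [RHS]mulrA.
Qed.

Lemma polar_int_rot p i : polar_int (ev (rotd p i)) = 0.
Proof.
have [->|->|->] := ord3_cases i; [exact: polar_int_rot_x| |exact: polar_int_rot_z].
rewrite rotd_comm (_ : ev _ = fun y => ev (rotd (rotd p (0 + 2)) 0) y
   + -1 * ev (rotd (rotd p 0) (0 + 2)) y); last by apply/funext => y; rewrite evD evN mulN1r.
rewrite polar_intD; [|exact: sep_cont_ev|exact: sep_contM (sep_cont_cst _) (sep_cont_ev _)].
by rewrite (polar_intZ _ (sep_cont_ev _)) polar_int_rot_x polar_int_rot_z mulr0 addr0.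
Qed.

Lemma polar_int_rotsum p : rotsum p -> polar_int (ev p) = 0.
Proof.
move=> /ev_rotsum [g hg]; rewrite (_ : ev p = fun y => ev (rotd (g 0) 0) y +
  ev (rotd (g (0 + 1)) (0 + 1)) y + ev (rotd (g (0 + 2)) (0 + 2)) y); last first.
  by apply/funext => y; rewrite hg (sum3 _ 0).
rewrite polar_intD; [|exact: sep_contD (sep_cont_ev _) (sep_cont_ev _)|exact: sep_cont_ev].
by rewrite polar_intD; [rewrite !polar_int_rot !addr0|exact: sep_cont_ev|exact: sep_cont_ev].
Qed.
End Sphere.

(** * Euclidean geometry and continuity on the sphere *)

Section Euclid.
Context {R : realType}.
Local Notation vec := 'rV[R]_3.
Implicit Types (u v w x y : vec) (a b : R).

Lemma dot3 u v : dot u v = u ord0 0 * v ord0 0 + u ord0 (0 + 1) * v ord0 (0 + 1)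
   + u ord0 (0 + 2) * v ord0 (0 + 2).
Proof. by rewrite /dot (sum3 _ 0). Qed.

Lemma dot_ge0 u : 0 <= dot u u.
Proof. by apply: sumr_ge0 => i _; rewrite -expr2 sqr_ge0. Qed.
Lemma enorm_ge0 u : 0 <= enorm u. Proof. exact: sqrtr_ge0. Qed.
Lemma enorm_sqr u : enorm u ^+ 2 = dot u u.
Proof. by rewrite sqr_sqrtr // dot_ge0. Qed.
Lemma dotC u v : dot u v = dot v u.
Proof. by apply: eq_bigr => i _; rewrite mulrC. Qed.

Lemma dot_le_enorm u v : dot u v <= enorm u * enorm v.
Proof.
have [h|h] := lerP (dot u v) 0; first by rewrite (le_trans h) ?mulr_ge0 ?enorm_ge0.
have h' := ltW h.
rewrite -(@ler_pXn2r _ 2) ?nnegrE ?mulr_ge0 ?enorm_ge0 // exprMn !enorm_sqr.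
rewrite -subr_ge0 !dot3.
set u0 := u _ _; set u1 := u _ _; set u2 := u _ _; set v0 := v _ _; set v1 := v _ _; set v2 := v _ _.
rewrite (_ : _ - _ = (u0 * v1 - u1 * v0) ^+ 2 + (u0 * v2 - u2 * v0) ^+ 2 +
  (u1 * v2 - u2 * v1) ^+ 2); last by ring.
by rewrite !addr_ge0 ?sqr_ge0.
Qed.

Lemma enorm_leP u a : 0 <= a -> (enorm u <= a) = (dot u u <= a ^+ 2).
Proof. by move=> a0; rewrite -enorm_sqr ler_pXn2r ?nnegrE ?enorm_ge0. Qed.

Lemma dotDl' u v w : dot (u + v) w = dot u w + dot v w.
Proof. by rewrite !dot3 !mxE; ring. Qed.
Lemma dotZl a u w : dot (a *: u) w = a * dot u w.
Proof. by rewrite !dot3 !mxE; ring. Qed.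
Lemma dotNl u w : dot (- u) w = - dot u w.
Proof. by rewrite !dot3 !mxE; ring. Qed.
Lemma dotDr u v w : dot w (u + v) = dot w u + dot w v.
Proof. by rewrite ![dot w _]dotC dotDl'. Qed.
Lemma dotZr a u w : dot w (a *: u) = a * dot w u.
Proof. by rewrite ![dot w _]dotC dotZl. Qed.
Lemma dotNr u w : dot w (- u) = - dot w u.
Proof. by rewrite ![dot w _]dotC dotNl. Qed.

Lemma enormD u v : enorm (u + v) <= enorm u + enorm v.
Proof.
rewrite enorm_leP ?addr_ge0 ?enorm_ge0 // dotDl' !dotDr sqrrD !enorm_sqr (dotC v u).
have := dot_le_enorm u v; lra.
Qed.
Lemma enormN u : enorm (- u) = enorm u.
Proof. by rewrite /enorm dotNl dotNr opprK. Qed.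

Lemma coord_le_enorm u i : `|u ord0 i| <= enorm u.
Proof.
rewrite -(@ler_pXn2r _ 2) ?nnegrE ?enorm_ge0 ?normr_ge0 // enorm_sqr real_normK ?num_real //.
rewrite /dot (bigD1 i) //= expr2 lerDl; apply: sumr_ge0 => j _.
by rewrite -expr2 sqr_ge0.
Qed.

Lemma enorm_le_coord u a : 0 <= a -> (forall i, `|u ord0 i| <= a) -> enorm u <= 2 * a.
Proof.
move=> a0 h; rewrite enorm_leP ?mulr_ge0 // dot3.
have H i : u ord0 i * u ord0 i <= a ^+ 2.
  by rewrite -expr2 -real_normK ?num_real // ler_pXn2r ?nnegrE.
have := H 0; have := H (0 + 1); have := H (0 + 2); have := sqr_ge0 a.
rewrite exprMn; lra.
Qed.

Lemma ballE u v a : 0 < a -> ball u a v <-> (forall i, `|u ord0 i - v ord0 i| < a).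
Proof.
move=> a0; split=> [[_ h] i|h]; first exact: (h ord0 i).
by split=> // i j; rewrite [i]ord1; apply: h.
Qed.

End Euclid.

Section SphereTopology.
Context {R : realType} (x0 : 'rV[R]_3) (r : R) (hr : 0 < r).
Local Notation vec := 'rV[R]_3.
Local Notation S := (sphere x0 r).
Implicit Types (p q : poly3 R) (u v w : 'I_3 -> poly3 R) (x y : vec) (i j : 'I_3) (t s : R) (f g : vec -> R).

Lemma sphereE x : S x <-> dot (x - x0) (x - x0) = r ^+ 2.
Proof.
rewrite /sphere /=; split=> [<-|e]; first by rewrite enorm_sqr.
by rewrite /enorm e sqrtr_sqr gtr0_norm.
Qed.

Lemma continuous_ev p : continuous (ev p).
Proof.
elim/mpoly_algind: p => [c|p q hp hq|i p hp] x.
- rewrite (_ : ev _ = cst c); first exact: cst_continuous.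
  by apply/funext => y; rewrite evC.
- rewrite (_ : ev _ = fun y => ev p y + ev q y); first by apply: continuousD; [exact: hp|exact: hq].
  by apply/funext => y; rewrite evD.
- rewrite (_ : ev _ = fun y => y ord0 i * ev p y).
    by apply: continuousM; [exact: coord_continuous|exact: hp].
  by apply/funext => y; rewrite evM evX.
Qed.

Lemma continuous_ev_sub p : continuous (fun x => ev p (x - x0)).
Proof.
have c1 : continuous (fun z : vec => z - x0).
  by move=> z; apply: continuousB; [exact: cvg_id|exact: cst_continuous].
by move=> x; apply: (@continuous_comp _ _ _ (fun z : vec => z - x0) (ev p)); [exact: c1|exact: continuous_ev].
Qed.

Lemma compact_sphere : compact S.
Proof.
apply: bounded_closed_compact.
  exists (enorm x0 + r); split; first exact: num_real.
  move=> M hM x /= Sx; rewrite [leLHS]/Num.Def.normr /= mx_normrE.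
  have M0 : 0 <= M by apply: ltW; apply: le_lt_trans hM; rewrite addr_ge0 ?enorm_ge0 ?ltW.
  apply: bigmax_le => // -[i j] _ /=; rewrite [i]ord1.
  apply: le_trans (coord_le_enorm _ _) _.
  by rewrite -[x](subrK x0) addrC (le_trans (enormD _ _)) // Sx ltW.
rewrite (_ : S = (fun x => ev (sqnorm R) (x - x0)) @^-1` [set r ^+ 2]).
  apply: closed_comp; last exact: closed_eq.
  by move=> x _; apply: continuous_ev_sub.
by apply/seteqP; split=> x; rewrite /= /sqnorm -dot_evv evv_X => /sphereE.
Qed.

Lemma within_ballP f : {within S, continuous f} -> forall x, S x -> forall e, 0 < e ->
  exists2 d, 0 < d & forall y, S y -> ball x d y -> `|f x - f y| < e.
Proof.
move=> /subspace_continuousP cf x Sx e e0.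
have /cvgrPdist_lt /(_ e e0) := cf x Sx.
rewrite near_withinE => /nbhs_ballP [d d0 hd]; exists d => // y Sy bxy.
exact: hd.
Qed.

(** Uniform continuity, from the covering form of compactness along the filter
    of small radii. *)
Lemma unif_sphere f : {within S, continuous f} -> forall e, 0 < e ->
  exists2 d, 0 < d & forall x y, S x -> S y -> ball x d y -> `|f x - f y| < e.
Proof.
move=> cf e e0; have e2 : 0 < e / 2 by rewrite divr_gt0.
have := compact_sphere; rewrite compact_near_coveringP => cov.
have := cov _ (0^'+ : set_system R) (fun d x => S x -> forall y, S y -> ball x d y -> `|f x - f y| < e) _.
have H : forall x, S x -> \forall x' \near x & d \near (0^'+ : set_system R),
    (S x' -> forall y, S y -> ball x' d y -> `|f x' - f y| < e).
  move=> x Sx; have [d d0 hd] := within_ballP cf Sx e2.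
  have d2 : 0 < d / 2 by rewrite divr_gt0.
  exists (ball x (d / 2), [set d' | d' <= d / 2]).
    split; first exact: nbhsx_ballx.
    exact: nbhs_right_le.
  move=> [x' d'] /= [bx' d'd] Sx' y Sy bx'y.
  have h1 := hd _ Sx' (le_ball (_ : d / 2 <= d) bx').
  have h2 : ball x d y.
    by rewrite (splitr d); apply: ball_triangle bx' _; apply: le_ball bx'y.
  have {}h2 := hd _ Sy h2.
  have {}h1 := h1 _.
  have h1' : `|f x - f x'| < e / 2 by apply: h1; rewrite ler_pdivrMr // ler_peMr ?ler1n // ltW.
  rewrite (_ : f x' - f y = (f x - f y) - (f x - f x')); last by ring.
  by rewrite (le_lt_trans (ler_normB _ _)) // (splitr e) ltrD.
move=> /(_ _ H) => hh.
have hh' : \forall d \near (0^'+ : set_system R), 0 < d /\ (S `<=` (fun x => S x -> forall y, S y -> ball x d y -> `|f x - f y| < e)).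
  near=> d; split; near: d; [exact: nbhs_right_gt|exact: hh].
have [d [d0 hd]] := filter_ex hh'.
by exists d => // x y Sx Sy; apply: hd.
Unshelve. all: by end_near. Qed.

Lemma bounded_sphere f : {within S, continuous f} -> exists2 M, 0 < M & forall x, S x -> `|f x| <= M.
Proof.
move=> cf; have /compact_bounded [M [_ hM]] := continuous_compact cf compact_sphere.
exists (`|M| + 1); first by rewrite ltr_wpDl.
move=> x Sx; apply: hM; last by exists x.
by rewrite (le_lt_trans (ler_norm M)) // ltrDl.
Qed.

(** A form of uniform continuity that can be averaged against a measure with
    small second moment. *)
Lemma quad_modulus f : {within S, continuous f} -> forall e, 0 < e ->
  exists2 C, 0 <= C & forall x y, S x -> S y -> `|f x - f y| <= e + C * dot (x - y) (x - y).
Proof.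
move=> cf e e0; have [d d0 hd] := unif_sphere cf e0; have [M M0 hM] := bounded_sphere cf.
exists (2 * M / d ^+ 2); first by rewrite divr_ge0 ?sqr_ge0 // mulr_ge0 // ltW.
move=> x y Sx Sy; have [/hd h|] := pselect (ball x d y).
  apply: le_trans (ltW (h Sx Sy)) _; rewrite lerDl mulr_ge0 ?dot_ge0 //.
  by rewrite divr_ge0 ?sqr_ge0 // mulr_ge0 // ltW.
rewrite ballE // => /existsNP [i /negP]; rewrite -leNgt => hi.
have h1 : `|f x - f y| <= 2 * M.
  by rewrite (le_trans (ler_normB _ _)) // mulr_natl mulr2n lerD ?hM.
have h2 : d ^+ 2 <= dot (x - y) (x - y).
  rewrite -enorm_sqr ler_pXn2r ?nnegrE ?enorm_ge0 ?(ltW d0) //.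
  apply: le_trans hi _; rewrite (_ : _ - _ = (x - y) ord0 i) ?coord_le_enorm //.
  by rewrite !mxE.
apply: le_trans h1 _; apply: ler_wpDl; first exact: ltW.
rewrite mulrAC ler_pdivlMr ?exprn_gt0 //.
by rewrite ler_pM2l // mulr_gt0.
Qed.
End SphereTopology.

(** * Weierstrass approximation on the sphere *)

Section Walk.
Context {R : realType} (r h : R) (hr : 0 < r).
Local Notation vec := 'rV[R]_3.
Implicit Types (l : seq 'I_3) (x z : vec) (g : vec -> R) (i j : 'I_3).

(** The expectation of g at the end of a random walk from z, with steps h or -h
    along the successive axes in l.  The probabilities (1 + x_i / r) / 2 and
    (1 - x_i / r) / 2 give the step the mean (h / r) x_i; they are polynomial
    in x, whence walk_poly. *)
Fixpoint walk x l g z : R :=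
  if l is i :: l' then
    (1 + x ord0 i / r) / 2 * walk x l' g (z + h *: evec i) +
    (1 - x ord0 i / r) / 2 * walk x l' g (z - h *: evec i)
  else g z.

Lemma walk_poly l g z : exists p, forall x, ev p x = walk x l g z.
Proof.
elim: l z => [|i l IH] z /=; first by exists (mpoly.mpolyC 3 (g z)) => x; rewrite evC.
have [p hp] := IH (z + h *: evec i); have [q hq] := IH (z - h *: evec i).
by have [f hf] := ev_mix p q i r; exists f => x; rewrite hf hp hq.
Qed.

Lemma walk_affine x l g a b z : walk x l (fun y => a + b * g y) z = a + b * walk x l g z.
Proof. by elim: l z => [|i l IH] z //=; rewrite !IH; field; exact: lt0r_neq0. Qed.

Section Inside.
Context (x : vec) (hx : forall i, `|x ord0 i| <= r).

Lemma weights_ge0 i : 0 <= (1 + x ord0 i / r) / 2 /\ 0 <= (1 - x ord0 i / r) / 2.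
Proof.
have := hx i; rewrite ler_norml => /andP[h1 h2].
have h3 : x ord0 i / r <= 1 by rewrite ler_pdivrMr // mul1r.
have h4 : -1 <= x ord0 i / r by rewrite ler_pdivlMr // mulN1r.
split; lra.
Qed.

Lemma le_walk l g g' z : (forall y, g y <= g' y) -> walk x l g z <= walk x l g' z.
Proof.
move=> hg; elim: l z => [|i l IH] z //=; have [w1 w2] := weights_ge0 i.
by apply: lerD; apply: ler_wpM2l.
Qed.

Fixpoint drift l : vec :=
  if l is i :: l' then (h * (x ord0 i / r)) *: evec i + drift l' else 0.

Lemma dot_evec (v : vec) i : dot v (evec i) = v ord0 i.
Proof. by rewrite dotC /dot sum_evec. Qed.

Lemma dot_add_evec (v : vec) a i :
  dot (v + a *: evec i) (v + a *: evec i) = dot v v + 2 * a * v ord0 i + a ^+ 2.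
Proof.
rewrite !(dotDl', dotDr, dotZl, dotZr) (dotC (evec i) v) !dot_evec mxE !eqxx /=.
by ring.
Qed.

(** Second moment about x: the square of the bias plus the variances of the
    steps, each of them at most h^2. *)
Lemma walk_sqr l z : walk x l (fun y => dot (y - x) (y - x)) z <=
  dot (z + drift l - x) (z + drift l - x) + (size l)%:R * h ^+ 2.
Proof.
elim: l z => [|i l IH] z /=; first by rewrite addr0 mul0r addr0.
have [w1 w2] := weights_ge0 i.
apply: (le_trans (lerD (ler_wpM2l w1 (IH _)) (ler_wpM2l w2 (IH _)))).
set v := z + drift l - x; set c := x ord0 i / r.
have -> : z + h *: evec i + drift l - x = v + h *: evec i by apply/rowP => j; rewrite !mxE; ring.
have -> : z - h *: evec i + drift l - x = v + (- h) *: evec i by apply/rowP => j; rewrite !mxE; ring.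
have -> : z + ((h * c) *: evec i + drift l) - x = v + (h * c) *: evec i by apply/rowP => j; rewrite !mxE; ring.
rewrite !dot_add_evec -natr1 -subr_ge0.
rewrite [leRHS](_ : _ = (h * c) ^+ 2); first exact: sqr_ge0.
by rewrite -/c; field.
Qed.

Definition rounds n : seq 'I_3 := flatten (nseq n [:: 0; 0 + 1; 0 + 2]).
Lemma size_rounds n : size (rounds n) = (3 * n)%N.
Proof. by elim: n => //= n IH; rewrite mulnS -IH. Qed.

Lemma drift_rounds n : drift (rounds n) = (n%:R * (h / r)) *: x.
Proof.
elim: n => [|n IH]; first by rewrite mul0r scale0r.
rewrite /= -/(rounds n) IH; apply/rowP => j; rewrite !mxE eqxx /= -natr1.
by have [->|->|->] := ord3_cases j; rewrite ?(eqxx, ord3_eqF) /=; ring.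
Qed.
End Inside.
End Walk.

Section Retract.
Context {R : realType} (r : R) (hr : 0 < r).
Local Notation vec := 'rV[R]_3.

(** A nearest point of the sphere, chosen arbitrarily when z is the centre. *)
Definition retract (z : vec) : vec :=
  if z == 0 then r *: evec 0 else (r / enorm z) *: z.

Lemma enormZ (a : R) (z : vec) : enorm (a *: z) = `|a| * enorm z.
Proof. by rewrite /enorm dotZl dotZr mulrA -expr2 sqrtrM ?sqr_ge0 // sqrtr_sqr. Qed.

Lemma enorm_gt0 (z : vec) : z != 0 -> 0 < enorm z.
Proof.
apply: contraNT; rewrite -leNgt => h; apply/eqP/rowP => i; rewrite mxE.
by apply/eqP; rewrite -normr_le0 (le_trans (coord_le_enorm _ _)).
Qed.

Lemma enorm_evec i : enorm (evec i : vec) = 1.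
Proof. by rewrite /enorm dot_evec mxE !eqxx sqrtr1. Qed.

Lemma enorm_retract z : enorm (retract z) = r.
Proof.
rewrite /retract; case: eqVneq => [_|/enorm_gt0 z0].
  by rewrite enormZ enorm_evec mulr1 gtr0_norm.
by rewrite enormZ gtr0_norm ?divr_gt0 // divfK // lt0r_neq0.
Qed.

Lemma retract_close z x : enorm x = r -> enorm (retract z - z) <= enorm (z - x).
Proof.
move=> hx; have -> : enorm (retract z - z) = `|r - enorm z|.
  rewrite /retract; case: eqVneq => [->|z0].
    by rewrite subr0 enormZ enorm_evec mulr1 /enorm dot3 !mxE !mul0r !addr0 sqrtr0 subr0.
  have z1 := enorm_gt0 z0.
  rewrite -[X in _ - X]scale1r -scalerBl enormZ -[X in _ * X]gtr0_norm // -normrM.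
  by rewrite mulrBl mul1r divfK // lt0r_neq0.
rewrite ler_norml; apply/andP; split.
  have := enormD (z - x) x; rewrite subrK hx; lra.
by have := enormD (- (z - x)) z; rewrite enormN opprB subrK hx; lra.
Qed.

Lemma retract_sqr z x : enorm x = r ->
  dot (retract z - x) (retract z - x) <= 4 * dot (z - x) (z - x).
Proof.
move=> hx; rewrite -!enorm_sqr.
have h1 : enorm (retract z - x) <= 2 * enorm (z - x).
  rewrite -[_ - x](subrKA z) (le_trans (enormD _ _)) //.
  by rewrite mulr_natl mulr2n lerD2r retract_close.
rewrite (_ : 4 * _ = (2 * enorm (z - x)) ^+ 2); last by ring.
by rewrite ler_pXn2r ?nnegrE ?mulr_ge0 ?enorm_ge0.
Qed.
End Retract.

Section Weierstrass.
Context {R : realType} (x0 : 'rV[R]_3) (r : R) (hr : 0 < r).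
Local Notation vec := 'rV[R]_3.
Local Notation S := (sphere x0 r).

(** A variant of Bernstein's proof: f is sampled at the point of the sphere
    nearest to the end of a walk of n rounds with step r / n.  Such a walk has
    mean x and second moment at most 3 r^2 / n about x. *)
Lemma sphere_weierstrass (f : vec -> R) : {within S, continuous f} ->
  forall e, 0 < e -> exists p, forall x, S x -> `|f x - ev p (x - x0)| < e.
Proof.
move=> cf e e0; have e2 : 0 < e / 2 by rewrite divr_gt0.
have [C C0 hC] := quad_modulus hr cf e2.
(* With this n, 4 C times the second moment is less than e / 2. *)
pose n := (Num.trunc (24 * C * r ^+ 2 / e)).+1.
have hn : 24 * C * r ^+ 2 / e < n%:R by apply: truncnS_gt.
have n0 : 0 < n%:R :> R by rewrite ltr0n.
pose h := r / n%:R.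
pose g z := f (x0 + retract r z).
have [p hp] := walk_poly r h (rounds n) g 0.
exists p => x Sx; rewrite hp; set y := x - x0.
have yr : enorm y = r by [].
have hy i : `|y ord0 i| <= r by rewrite -yr coord_le_enorm.
pose q z := dot (z - y) (z - y).
have gq z : `|g z - f x| <= e / 2 + (4 * C) * q z.
  have Sz : S (x0 + retract r z) by rewrite /sphere /= addrAC subrr add0r enorm_retract.
  apply: le_trans (hC _ _ Sz Sx) _; rewrite lerD2l -mulrA mulrCA ler_wpM2l //.
  rewrite (_ : x0 + _ - x = retract r z - y); first exact: retract_sqr.
  by rewrite /y opprB addrCA addrA.
have hq : walk r h y (rounds n) q 0 <= 3 * r ^+ 2 / n%:R.
  apply: le_trans (walk_sqr h hr hy _ _) _.
  rewrite drift_rounds add0r (_ : _ * (h / r) = 1); last first.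
    by rewrite /h; field; rewrite !lt0r_neq0.
  rewrite scale1r subrr -[X in dot X _](scale0r 0) dotZl mul0r add0r size_rounds natrM.
  by rewrite (_ : _ * _ = 3 * r ^+ 2 / n%:R) // /h; field; rewrite lt0r_neq0.
have q_le : walk r h y (rounds n) (fun z => e / 2 + (4 * C) * q z) 0 < e.
  rewrite walk_affine // -/q [ltRHS](splitr e) ltrD2l.
  have h4 : 4 * C * (3 * r ^+ 2 / n%:R) < e / 2.
    rewrite (_ : _ * _ = (24 * C * r ^+ 2 / e) * (e / 2) / n%:R); last first.
      by field; rewrite !lt0r_neq0.
    by rewrite ltr_pdivrMr // mulrC ltr_pM2l.
  by apply: le_lt_trans h4; rewrite ler_wpM2l // mulr_ge0.
have wB g' (G : vec -> R) : (forall z, g' z <= G z) ->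
    walk r h y (rounds n) g' 0 <= walk r h y (rounds n) G 0 by apply: le_walk.
rewrite distrC ltr_norml; apply/andP; split.
- have h1 : walk r h y (rounds n) (fun z => f x + (-1) * g z) 0 < e.
    apply: le_lt_trans q_le; apply: wB => z; have := gq z.
    by rewrite ler_norml => /andP[h1 _]; rewrite mulN1r; lra.
  by move: h1; rewrite walk_affine // mulN1r; lra.
- have h1 : walk r h y (rounds n) (fun z => - f x + 1 * g z) 0 < e.
    apply: le_lt_trans q_le; apply: wB => z; have := gq z.
    by rewrite ler_norml => /andP[_ h1]; rewrite mul1r; lra.
  by move: h1; rewrite walk_affine // mul1r; lra.
Qed.
End Weierstrass.

(** * Integration over the sphere *)

Section SphereIntegral.
Context {R : realType} (x0 : 'rV[R]_3) (r : R) (hr : 0 < r).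
Local Notation vec := 'rV[R]_3.
Local Notation S := (sphere x0 r).
Implicit Types (p q : poly3 R) (x y b : vec) (i j : 'I_3) (t s : R) (f g : vec -> R).

Local Notation J := (sphere_integral x0 r).
Definition sphere_cont f := sep_cont (fun t s => f (sphere_param x0 r t s)).

Lemma sphere_paramE t s : sphere_param x0 r t s = x0 + sphere_pt r t s. Proof. by []. Qed.
Lemma sphere_param_sub t s : sphere_param x0 r t s - x0 = sphere_pt r t s.
Proof. by rewrite sphere_paramE addrAC subrr add0r. Qed.
Lemma sphere_param_in t s : S (sphere_param x0 r t s).
Proof. by apply/(sphereE x0 hr); rewrite sphere_param_sub dot_yp. Qed.

Lemma sphere_integral_polar f : J (fun x => f (x - x0)) = polar_int r f.
Proof. by apply: eq_iterint => t s; rewrite sphere_param_sub. Qed.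

Lemma continuous_within_comp (T : topologicalType) (k : T -> vec) f :
  continuous k -> (forall z, S (k z)) -> {within S, continuous f} -> continuous (f \o k).
Proof.
move=> ck kS /subspace_continuousP cf z; apply: cvg_comp (cf _ (kS z)) => U.
rewrite /within /= => hU; have := ck z _ hU; rewrite /nbhs /=.
by apply: filterS => z' /=; apply; exact: kS.
Qed.

Lemma continuous_param_t s : continuous (sphere_param x0 r ^~ s).
Proof.
move=> t; apply: differentiable_continuous; apply/derivable1_diffP.
apply/derivable_mxP => i j; rewrite [i]ord1.
have d := yp_dt r t s j.
rewrite (_ : (fun t => _) = cst (x0 ord0 j) + (fun t => sphere_pt r t s ord0 j)); last first.
  by apply/funext => t'; rewrite sphere_paramE mxE.
exact: ex_derive.
Qed.
Lemma continuous_param_s t : continuous (sphere_param x0 r t).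
Proof.
move=> s; apply: differentiable_continuous; apply/derivable1_diffP.
apply/derivable_mxP => i j; rewrite [i]ord1.
have d := yp_ds r t s j.
rewrite (_ : (fun s => _) = cst (x0 ord0 j) + (fun s => sphere_pt r t s ord0 j)); last first.
  by apply/funext => t'; rewrite sphere_paramE mxE.
exact: ex_derive.
Qed.

Lemma sphere_cont_within f : {within S, continuous f} -> sphere_cont f.
Proof.
move=> cf; split=> [t|s|].
- apply: continuous_within_comp cf => [|s]; [exact: continuous_param_s|exact: sphere_param_in].
- apply: (@continuous_within_comp _ (sphere_param x0 r ^~ s) f) => [|t|//]; [exact: continuous_param_t|exact: sphere_param_in].
- by have [M _ hM] := bounded_sphere hr cf; exists M => t s; apply/hM/sphere_param_in.
Qed.

Lemma sphere_contD f g : sphere_cont f -> sphere_cont g -> sphere_cont (fun x => f x + g x). Proof. exact: sep_contD. Qed.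
Lemma sphere_contM f g : sphere_cont f -> sphere_cont g -> sphere_cont (fun x => f x * g x). Proof. exact: sep_contM. Qed.
Lemma sphere_cont_cst (c : R) : sphere_cont (fun _ => c). Proof. exact: sep_cont_cst. Qed.
Lemma sphere_cont_ev p : sphere_cont (fun x => ev p (x - x0)).
Proof. by rewrite /sphere_cont; under eq_fun do under eq_fun do rewrite sphere_param_sub; exact: sep_cont_ev. Qed.

Lemma sphere_cont_dot (F G : vec -> vec) : (forall i, sphere_cont (fun x => F x ord0 i)) ->
  (forall i, sphere_cont (fun x => G x ord0 i)) -> sphere_cont (fun x => dot (F x) (G x)).
Proof.
move=> hF hG; rewrite (_ : (fun x => _) = fun x => F x ord0 0 * G x ord0 0 +
  F x ord0 (0 + 1) * G x ord0 (0 + 1) + F x ord0 (0 + 2) * G x ord0 (0 + 2)).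
  by apply: sphere_contD; [apply: sphere_contD|]; apply: sphere_contM.
by apply/funext => x; rewrite dot3.
Qed.

Lemma sphere_integralD f g : sphere_cont f -> sphere_cont g -> J (fun x => f x + g x) = J f + J g.
Proof.
move=> hf hg; rewrite /sphere_integral -!/(iterint _) -iterintD; try exact: sep_cont_weight.
by apply: eq_iterint => t s; rewrite [LHS]mulrDl.
Qed.
Lemma sphere_integralZ (c : R) f : sphere_cont f -> J (fun x => c * f x) = c * J f.
Proof.
move=> hf; rewrite /sphere_integral -!/(iterint _) -iterintZ; try exact: sep_cont_weight.
by apply: eq_iterint => t s; rewrite [RHS]mulrA.
Qed.
Lemma eq_sphere_integral f g : (forall x, S x -> f x = g x) -> J f = J g.
Proof. by move=> e; apply: eq_iterint => t s; rewrite e //; exact: sphere_param_in. Qed.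

Definition area : R := J (fun=> 1).
Lemma areaE : area = 4 * pi * r ^+ 2.
Proof.
rewrite /area /sphere_integral.
have inn t : \int[lebesgue_measure]_(s in `[0, 2 * pi]) (1 * (r ^+ 2 * sin t)) =
    2 * pi * r ^+ 2 * sin t.
  have d s : is_derive (s : R) 1 (fun s => s * (r ^+ 2 * sin t)) (1 * (r ^+ 2 * sin t)).
    by apply: is_derive_eq; rewrite scaler0 add0r /GRing.scale /= mulrC.
  rewrite (Rint_FTC pi2_gt0 d) ?mul0r ?subr0 ?mulrA //.
  exact: cst_continuous.
under eq_Rintegral do rewrite inn.
have d t : is_derive (t : R) 1 (fun t => - (2 * pi * r ^+ 2) * cos t) (2 * pi * r ^+ 2 * sin t).
  by apply: is_derive_eq; rewrite /GRing.scale /=; ring.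
rewrite (Rint_FTC (pi_gt0 R) d); first by rewrite cospi cos0; ring.
by move=> t; apply: cvgM; [exact: cvg_cst|exact: continuous_sin].
Qed.
Lemma area_gt0 : 0 < area.
Proof. by rewrite areaE !mulr_gt0 ?pi_gt0 // exprn_gt0. Qed.

Lemma le_sphere_integral f (M : R) : sphere_cont f -> (forall x, S x -> f x <= M) -> J f <= M * area.
Proof.
move=> hf hM; rewrite -sphere_integralZ; last exact: sphere_cont_cst.
apply: le_iterint => [||t s /andP[t0 tp]].
- exact: sep_cont_weight.
- by apply: sep_cont_weight; exact: sphere_cont_cst.
rewrite mulr1 ler_wpM2r ?hM //; last exact: sphere_param_in.
by rewrite mulr_ge0 ?sqr_ge0 // sin_ge0_pi // t0.
Qed.

Lemma sphere_integral_rotsum p : rotsum p -> J (fun x => ev p (x - x0)) = 0.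
Proof. by move=> hp; rewrite (sphere_integral_polar (ev p)) polar_int_rotsum. Qed.
End SphereIntegral.

Section Completeness.
Context {R : realType} (lam mu : R) (x0 : 'rV[R]_3) (r : R).
Context (hmu : 0 < mu) (hlam : 0 < 3 * lam + 2 * mu) (hr : 0 < r).
Local Notation vec := 'rV[R]_3.
Local Notation S := (sphere x0 r).
Local Notation J := (sphere_integral x0 r).
Local Notation nu := (unit_normal x0 r).
Local Notation bdata := (bdata lam mu x0 r).
Local Notation tangential := (tangential x0 r).
Implicit Types (p q : poly3 R) (u : 'I_3 -> poly3 R) (x y b : vec) (i j : 'I_3).

Lemma dot_nu x : S x -> dot (nu x) (nu x) = 1.
Proof.
move=> /(sphereE x0 hr) e; rewrite dotZl dotZr e.
by field; rewrite lt0r_neq0.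
Qed.

Lemma dot_tangential_nu t x : S x -> dot (tangential t x) (nu x) = 0.
Proof.
by move=> Sx; rewrite /tangential dotDl' dotNl dotZl dot_nu // mulr1 subrr.
Qed.

Lemma tangential_id t x : dot t (nu x) = 0 -> tangential t x = t.
Proof. by move=> e; rewrite /tangential e scale0r subr0. Qed.

Lemma tangential_normal (a : R) x : S x -> tangential (a *: (x - x0)) x = 0.
Proof.
move=> Sx; rewrite (_ : a *: (x - x0) = (a * r) *: nu x).
  by rewrite /tangential dotZl dot_nu // mulr1 subrr.
by rewrite /unit_normal scalerA mulfK // lt0r_neq0.
Qed.

Lemma enorm_tangential t x : S x -> enorm (tangential t x) <= enorm t.
Proof.
move=> Sx; rewrite enorm_leP ?enorm_ge0 // enorm_sqr /tangential.
move: (nu x) (dot_nu Sx) => n n1.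
rewrite !(dotDl', dotDr, dotNl, dotNr, dotZl, dotZr) n1 (dotC n t).
have := sqr_ge0 (dot t n); lra.
Qed.

Lemma dot_cross_r (b y : vec) : dot y (cross b y) = 0.
Proof. by rewrite dot3 /cross !mxE !ord3E; ring. Qed.

Lemma tangential_cross t b x : dot (tangential t x) (cross b (x - x0)) = dot t (cross b (x - x0)).
Proof.
by rewrite /tangential dotDl' dotNl dotZl /unit_normal dotZl dot_cross_r !mulr0 subr0.
Qed.

Lemma cross_rigid (b y : vec) : cross b y = evv (rigid (fun i => b ord0 i)) y.
Proof.
apply/rowP => i; rewrite !mxE /rigid /crossv evD evN !evM !evC !evX //.
Qed.

Lemma scontZ (c : R) (f : vec -> R) : continuous f -> continuous (fun x => c * f x).
Proof. by move=> cf x; apply: (@cvgM _ _ (nbhs x) _ (fun=> c) f); [exact: cvg_cst|exact: cf]. Qed.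
Lemma vcontD (F G : vec -> vec) : continuous F -> continuous G -> continuous (fun x => F x + G x).
Proof. by move=> cF cG x; apply: (@cvgD _ _ _ (nbhs x) _ F G); [exact: cF|exact: cG]. Qed.
Lemma vcontB (F G : vec -> vec) : continuous F -> continuous G -> continuous (fun x => F x - G x).
Proof. by move=> cF cG x; apply: (@cvgB _ _ _ (nbhs x) _ F G); [exact: cF|exact: cG]. Qed.
Lemma vcontZ (f : vec -> R) (G : vec -> vec) : continuous f -> continuous G -> continuous (fun x => f x *: G x).
Proof. by move=> cf cG x; apply: (@cvgZ _ _ _ (nbhs x) _ f G); [exact: cf|exact: cG]. Qed.

Lemma vcont3 (f g h : vec -> R) (a b c : vec) : continuous f -> continuous g -> continuous h ->
  continuous (fun x => f x *: a + g x *: b + h x *: c).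
Proof.
have cZ (k : vec -> R) (d : vec) : continuous k -> continuous (fun x => k x *: d).
  by move=> ck; apply: (@vcontZ k (fun=> d) ck); exact: cst_continuous.
move=> cf cg ch; apply: (@vcontD (fun x => f x *: a + g x *: b) (fun x => h x *: c)); last exact: cZ.
by apply: (@vcontD (fun x => f x *: a) (fun x => g x *: b)); exact: cZ.
Qed.

Lemma continuous_evv_sub u : continuous (fun x => evv u (x - x0)).
Proof.
rewrite (_ : (fun x => _) = fun x => ev (u 0) (x - x0) *: evec 0 +
  ev (u (0 + 1)) (x - x0) *: evec (0 + 1) + ev (u (0 + 2)) (x - x0) *: evec (0 + 2)).
  by apply: vcont3; exact: continuous_ev_sub.
apply/funext => x; apply/rowP => j; rewrite !mxE eqxx /=.
by have [->|->|->] := ord3_cases j; rewrite ?(eqxx, ord3_eqF) /=; ring.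
Qed.

(** Rigid rotations do no work against the tractions of elastic fields. *)
Lemma sphere_integral_traction u b : elastic lam mu u ->
  J (fun x => dot ((bdata u).2 x) (cross b (x - x0))) = 0.
Proof.
move=> eu; pose q := dotv (traction lam mu u) (rigid (fun i => b ord0 i)).
have e x : dot ((bdata u).2 x) (cross b (x - x0)) = r^-1 * ev q (x - x0).
  by rewrite /= tangential_cross dotZl cross_rigid dot_evv.
rewrite (eq_sphere_integral hr (fun x _ => e x)) sphere_integralZ; last exact: sphere_cont_ev.
by rewrite sphere_integral_rotsum ?mulr0 //; apply: rotsum_traction.
Qed.

Lemma bdata_in_Vtilde u : elastic lam mu u -> Vtilde x0 r (bdata u).
Proof.
move=> eu; split.
- by apply: continuous_subspaceT; apply: scontZ; exact: continuous_ev_sub.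
- apply: continuous_subspaceT; rewrite /= /tangential.
  have c1 : continuous (fun x => r^-1 *: evv (traction lam mu u) (x - x0)).
    by apply: (@vcontZ (fun=> r^-1)); [exact: cst_continuous|exact: continuous_evv_sub].
  have c2 : continuous (nu : vec -> vec).
    by apply: (@vcontZ (fun=> r^-1)); [exact: cst_continuous|apply: (@vcontB id (fun=> x0)); [move=> z; exact: cvg_id|exact: cst_continuous]].
  apply: vcontB; first exact: c1.
  apply: vcontZ; last exact: c2.
  have -> : (fun x => dot (r^-1 *: evv (traction lam mu u) (x - x0)) (nu x)) =
      fun x => r^-2 * ev (dotv (traction lam mu u) (X R)) (x - x0).
    apply/funext => z; rewrite dotZl dotZr -[z - x0 in X in dot _ X]evv_X dot_evv.
    by rewrite mulrA -expr2 exprVn.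
  by apply: scontZ; exact: continuous_ev_sub.
- by move=> x Sx; apply: dot_tangential_nu.
- by move=> b; apply: sphere_integral_traction.
Qed.

Lemma solves_bdata u f G x : solves lam mu r u f G -> S x ->
  (bdata u).1 x = r^-1 * ev f (x - x0) /\ (bdata u).2 x = tangential (r^-1 *: evv G (x - x0)) x.
Proof.
move=> [_ hf hG] Sx.
have hN : ev (sqnorm R) (x - x0) = r ^+ 2.
  by rewrite /sqnorm -dot_evv evv_X; apply/(sphereE x0 hr).
split; first by rewrite /= (eqS_ev hf hN).
have [a ha] := tanS_ev hG hN.
rewrite /= (_ : _ *: evv _ _ = 1 *: (r^-1 *: evv G (x - x0)) + 1 *: ((r^-1 * a) *: (x - x0))).
  by rewrite tangential_lin tangential_normal // scaler0 addr0 scale1r.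
by apply/rowP => i; rewrite !mxE ha !mxE; ring.
Qed.
End Completeness.

(** * Density *)

Section Density.
Context {R : realType} (lam mu : R) (x0 : 'rV[R]_3) (r : R).
Context (hmu : 0 < mu) (hlam : 0 < 3 * lam + 2 * mu) (hr : 0 < r).
Local Notation vec := 'rV[R]_3.
Local Notation S := (sphere x0 r).
Local Notation J := (sphere_integral x0 r).
Local Notation sphere_cont := (sphere_cont x0 r).
Local Notation bdata := (bdata lam mu x0 r).
Local Notation tangential := (tangential x0 r).
Implicit Types (p q : poly3 R) (u : 'I_3 -> poly3 R) (x y b : vec) (i j : 'I_3).

Lemma enorm_cross (a b : vec) : enorm (cross a b) <= enorm a * enorm b.
Proof.
rewrite enorm_leP ?mulr_ge0 ?enorm_ge0 // exprMn !enorm_sqr.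
rewrite -subr_ge0 (_ : _ - _ = (dot a b) ^+ 2) ?sqr_ge0 //.
by rewrite !dot3 /cross !mxE !ord3E; ring.
Qed.

Lemma within_coord (F : vec -> vec) i : {within S, continuous F} ->
  {within S, continuous (fun x => F x ord0 i)}.
Proof.
move=> /subspace_continuousP cF; apply/subspace_continuousP => x Sx.
apply: (@cvg_comp _ _ _ F (fun v : vec => v ord0 i) _ _ _ (cF x Sx)).
exact: coord_continuous.
Qed.

Lemma evv_crossX (c : 'I_3 -> R) y :
  evv (crossv (X R) (cstv c)) y = cross y (\row_i c i).
Proof.
by apply/rowP => i; rewrite !mxE /crossv /cstv evD evN !evM !evC !evX.
Qed.

Lemma crossNC (c y : vec) : cross (- c) y = cross y c.
Proof. by apply/rowP => i; rewrite !mxE; ring. Qed.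

Lemma small_coef (a b d : R) : 0 < a -> 0 < b ->
  2 / 3 * a ^+ 2 * b <= 2 * d * (b * a) -> a <= 3 * d.
Proof. by move=> a0 b0 h; rewrite -(ler_pM2r (mulr_gt0 a0 b0)); move: h; lra. Qed.

Lemma sphere_integral_cross_sqr (c : vec) :
  J (fun x => dot (cross (x - x0) c) (cross (x - x0) c)) = 2 / 3 * dot c c * r ^+ 2 * area x0 r.
Proof.
set k := 2 / 3 * dot c c.
have Sw : sphere_cont (fun x => dot (cross (x - x0) c) (cross (x - x0) c)).
  rewrite (_ : (fun x => _) = fun x => ev (dotv (crossv (X R) (cstv (c ord0)))
     (crossv (X R) (cstv (c ord0)))) (x - x0)); first exact: sphere_cont_ev.
  apply/funext => x; rewrite -dot_evv !evv_crossX (_ : \row_i _ = c) //.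
  by apply/rowP => i; rewrite mxE.
have := sphere_integral_rotsum x0 hr (rotsum_cross (c ord0)).
rewrite (eq_sphere_integral hr (g := fun x => dot (cross (x - x0) c) (cross (x - x0) c) + (- (k * r ^+ 2)) * 1)).
  rewrite (sphere_integralD Sw (sphere_contM (sphere_cont_cst _ _ _) (sphere_cont_cst _ _ _))) sphere_integralZ; last exact: sphere_cont_cst.
  by rewrite -/(area x0 r) mulNr => /eqP; rewrite subr_eq0 => /eqP.
move=> x Sx; rewrite evD evN evM evC.
rewrite -(dot_evv (crossv (X R) (cstv (c ord0)))) !evv_crossX /sqnorm -(dot_evv (X R)) evv_X.
rewrite (iffLR (sphereE x0 hr x) Sx) (_ : \row_i _ = c); last by apply/rowP => i; rewrite mxE.
rewrite /k mulr1; congr (_ - _ * _); by rewrite dot3 (sum3 _ 0); field.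
Qed.

(** The polynomial problem is solved for approximations f0 and P of the data;
    the defect y /\ C of the tangential part is bounded through the moment
    condition. *)
Lemma density (g : (vec -> R) * (vec -> vec)) (eps : R) : Vtilde x0 r g -> 0 < eps -> exists2 u, elastic lam mu u &
  forall x, S x -> `|g.1 x - (bdata u).1 x| < eps /\ enorm (g.2 x - (bdata u).2 x) < eps.
Proof.
case: g => f F [cg1 cg2 tg2 ig2] e0; simpl in cg1, cg2, tg2, ig2.
pose d := eps / 6; have d0 : 0 < d by rewrite divr_gt0.
have d5 : 2 * d + 3 * d < eps by rewrite /d; lra.
have [f0 hf0] := sphere_weierstrass hr cg1 e0.
have [q hq] := ev_scale r f0.
have [u1 hu1] := normal_solution q hmu hlam hr.
have /choice [P hP] i := sphere_weierstrass hr (within_coord (i := i) cg2) d0.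
have /choice [P' hP'] i := ev_scale r (P i).
have [c [u2 hu2]] := tangential_solution P' hmu hlam hr.
pose C : vec := \row_i c i; pose w x := cross (x - x0) C.
pose Px x := evv P (x - x0).
have eu1 : elastic lam mu u1 by case: hu1.
have eu2 : elastic lam mu u2 by case: hu2.
have r0 := lt0r_neq0 hr.
have bd1 x : S x -> (bdata u1).1 x = ev f0 (x - x0) /\ (bdata u1).2 x = 0.
  move=> Sx; have [-> ->] := solves_bdata hr hu1 Sx; split; first by rewrite hq mulKf.
  rewrite (_ : evv _ _ = 0) ?scaler0; last by apply/rowP => i; rewrite !mxE ev0.
  by rewrite tangential_id // -(scale0r 0) dotZl mul0r.
have bd2 x : S x -> (bdata u2).1 x = 0 /\ (bdata u2).2 x = tangential (Px x + r^-1 *: w x) x.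
  move=> Sx; have [-> ->] := solves_bdata hr hu2 Sx; split; first by rewrite ev0 mulr0.
  congr tangential; apply/rowP => i; rewrite !mxE evD hP' mulrDr mulKf //.
  by rewrite /crossv /cstv evD evN !evM !evC !evX !mxE.
(* The Euclidean norm of three coordinates less than d is less than 2 d. *)
have FP x : S x -> enorm (F x - Px x) <= 2 * d.
  move=> Sx; apply: enorm_le_coord => [|i]; first exact: ltW.
  by rewrite !mxE ltW // hP.
have normw x : S x -> enorm (w x) <= r * enorm C.
  by move=> Sx; rewrite (le_trans (enorm_cross _ _)) // Sx.
have Sw i : sphere_cont (fun x => w x ord0 i).
  rewrite (_ : (fun x => _) = fun x => ev (crossv (X R) (cstv c) i) (x - x0)).
    exact: sphere_cont_ev.
  by apply/funext => x; rewrite /w -evv_crossX mxE.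
have SF i : sphere_cont (fun x => F x ord0 i) by apply: sphere_cont_within => //; exact: within_coord.
have SP i : sphere_cont (fun x => Px x ord0 i).
  by rewrite (_ : (fun x => _) = fun x => ev (P i) (x - x0)); [exact: sphere_cont_ev|apply/funext => x; rewrite mxE].
(* Both F and the elastic data have zero moment against w, the rotation of
   axis -C. *)
have JF : J (fun x => dot (F x) (w x)) = 0.
  by rewrite -(ig2 (- C)); apply: (eq_sphere_integral hr) => x _; rewrite crossNC.
have JP : J (fun x => dot (Px x) (w x)) = - (r^-1 * J (fun x => dot (w x) (w x))).
  have := sphere_integral_traction x0 hmu hlam hr (- C) eu2.
  rewrite (eq_sphere_integral hr (g := fun x => dot (Px x) (w x) + r^-1 * dot (w x) (w x))); last first.
    by move=> x Sx; rewrite (bd2 x Sx).2 tangential_cross crossNC -/(w x) dotDl' dotZl.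
  rewrite sphere_integralD ?sphere_integralZ; first by move/eqP; rewrite addr_eq0 => /eqP.
  - exact: sphere_cont_dot.
  - exact: sphere_cont_dot.
  - by apply: sphere_contM; [exact: sphere_cont_cst|exact: sphere_cont_dot].
have SFw : sphere_cont (fun x => dot (F x) (w x)) by apply: sphere_cont_dot.
have SPw : sphere_cont (fun x => dot (Px x) (w x)) by apply: sphere_cont_dot.
have SPw' : sphere_cont (fun x => (-1) * dot (Px x) (w x)) by apply: sphere_contM => //; apply: sphere_cont_cst.
have bound x : S x -> dot (F x) (w x) + (-1) * dot (Px x) (w x) <= 2 * d * (r * enorm C).
  move=> Sx; rewrite -dotZl -dotDl' scaleN1r (le_trans (dot_le_enorm _ _)) //.
  by rewrite ler_pM ?enorm_ge0 ?FP ?normw.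
have := le_sphere_integral hr (sphere_contD SFw SPw') bound.
rewrite (sphere_integralD SFw SPw') (sphere_integralZ _ SPw) JF JP sphere_integral_cross_sqr => ineq.
have hC : enorm C <= 3 * d.
  have A0 := area_gt0 x0 hr.
  have {}ineq : 2 / 3 * enorm C ^+ 2 * r <= 2 * d * (r * enorm C).
    rewrite enorm_sqr -(ler_pM2r A0); apply: le_trans ineq.
    by rewrite le_eqVlt (_ : _ == _) //; apply/eqP; field.
  have [C0|C0] := eqVneq (enorm C) 0; first by rewrite C0 mulr_ge0 // ltW.
  have {}C0 : 0 < enorm C by rewrite lt_neqAle eq_sym C0 enorm_ge0.
  exact: small_coef C0 hr ineq.
exists (lincomb 1 u1 1 u2); first exact: elastic_lin.
have [e1 e2] := bdata_add lam mu x0 r u1 u2.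
move=> x Sx; have [b1 b1'] := bd1 x Sx; have [b2 b2'] := bd2 x Sx.
have E1 := etrans (e1 x) (etrans (f_equal2 +%R b1 b2) (addr0 _)).
have E2 := etrans (e2 x) (etrans (f_equal2 +%R b1' b2') (add0r _)).
change (`|f x - (bdata (lincomb 1 u1 1 u2)).1 x| < eps /\
  enorm (F x - (bdata (lincomb 1 u1 1 u2)).2 x) < eps).
rewrite E1 E2; split; first exact: hf0.
have -> : F x - tangential (Px x + r^-1 *: w x) x =
    tangential (F x - Px x) x + - tangential (r^-1 *: w x) x.
  rewrite -{1}(tangential_id (tg2 x Sx)).
  have -> : Px x + r^-1 *: w x = 1 *: Px x + 1 *: (r^-1 *: w x) by rewrite !scale1r.
  have -> : F x - Px x = 1 *: F x + (-1) *: Px x by rewrite scale1r scaleN1r.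
  by rewrite !tangential_lin !scale1r scaleN1r opprD addrA.
apply: le_lt_trans (enormD _ _) _; rewrite enormN.
apply: (@le_lt_trans _ _ (2 * d + 3 * d)); last exact: d5.
apply: lerD; first exact: le_trans (enorm_tangential hr _ Sx) (FP x Sx).
apply: le_trans (enorm_tangential hr _ Sx) _.
rewrite enormZ gtr0_norm ?invr_gt0 // ler_pdivrMl //.
by apply: le_trans (normw x Sx) _; rewrite ler_pM2l.
Qed.
End Density.

Theorem theorem23 (R : realType) (lam mu : R)
    (hmu : 0 < mu) (hlam : 0 < 3 * lam + 2 * mu)
    (x0 : 'rV[R]_3) (r : R) (hr : 0 < r)
    (omega : forall k : nat, 'I_(2 * k).+1 -> ('rV[R]_3 -> R))
    (homega : forall k : nat, is_basis (harmonic_homog k) (omega k))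
    (idx : nat -> elastic_index) (hidx : bijective idx) :
  let p : nat -> 'rV[R]_3 -> 'rV[R]_3 :=
    fun k => elastic_system lam mu omega (idx k) in
  complete_in (sphere x0 r)
    (fun k => boundary_pair lam mu x0 r (p k)) (Vtilde x0 r).
Proof.
move=> p; split.
- move=> z [n [c ->]].
  suff [u eu ->] : exists2 u, elastic lam mu u &
    \sum_(k < n) c k *: boundary_pair lam mu x0 r (p k) = bdata lam mu x0 r u.
    exact: bdata_in_Vtilde.
  elim: n => [|n [u eu IH]].
    exists (zerov R); first exact: elastic_zerov.
    rewrite big_ord0 (eq_bdata _ _ _ _ (u := zerov R) (v := lincomb 0 (zerov R) 0 (zerov R))).
      by rewrite bdata_lin !scale0r addr0.
    by move=> i; rewrite lincomb0.
  have [v ev hv] : exists2 v, elastic lam mu v & boundary_pair lam mu x0 r (p n) = bdata lam mu x0 r v.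
    rewrite /p; case: (idx n) => k [s j] /=.
    have [q hq ->] := harmonic_homogP (let: And3 h _ _ := homega k in h s).
    exists (fun i => shift x0 (elastic_field lam mu k (single j q) i)).
      by apply: elastic_shift; apply: elastic_elastic_field => //; apply: harm_single.
    rewrite elastic_polyE; exact: bdata_shift.
  exists (lincomb 1 u (c n) v); first exact: elastic_lin.
  by rewrite big_ord_recr /= IH bdata_lin scale1r hv.
- move=> g hg eps e0; have [u eu hu] := density hmu hlam hr hg e0.
  exists (bdata lam mu x0 r u); last exact: hu.
  exact: span_elastic.
Qed.
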